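(* Let $K$ be a field, let $A_3=K[x_1,x_2,x_3]$, let $D$ be a non-negative integer, and let $I\subseteq A_3$ be a homogeneous radical ideal generated in degrees $\leq D$. Then there is $n_0\in\mathbb{N}$ such that for all $n\geq n_0$ the symbolic power $I^{(n)}$ is generated in degrees $<(D+1)n$.
   Context: The polynomial ring $A=A_3$ carries the standard grading. For an ideal $I$ of $A$, the $n$-th symbolic power is $I^{(n)}:=\bigcap_{\mathfrak p\in \mathrm{Ass}(I)}(I^nA_{\mathfrak p}\cap A)$, where $\mathrm{Ass}(I)$ denotes the set of associated primes of $A/I$. An ideal is generated in degrees $\leq d$ (resp. $<d$) if it has a generating set consisting of polynomials of degree $\leq d$ (resp. $<d$); for a homogeneous ideal these may be taken homogeneous. *)

(* Defs.v *)
From HB Require Import structures.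
From mathcomp Require Import all_boot all_order all_algebra.
From mathcomp.algebra Require Import fraction.
From mathcomp.multinomials Require Import mpoly.

Set Implicit Arguments.
Unset Strict Implicit.
Unset Printing Implicit Defensive.

Import GRing.Theory.
Local Open Scope ring_scope.

(* Ideals are Prop-valued predicates: the ideals of ring_quotient.v are
   decidable and proper, while here the unit ideal is allowed and
   intersections over all associated primes have to be formed. *)

Definition is_ideal (R : comNzRingType) (I : R -> Prop) : Prop :=
  [/\ I 0, (forall a b, I a -> I b -> I (a + b))
    & (forall a b, I b -> I (a * b))].

Definition is_radical (R : comNzRingType) (I : R -> Prop) : Prop :=
  forall (a : R) (k : nat), I (a ^+ k) -> I a.

Definition is_prime (R : comNzRingType) (P : R -> Prop) : Prop :=
  [/\ is_ideal P, ~ P 1 & forall a b, P (a * b) -> P a \/ P b].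

(* The finite sums of products a * s with a in B and s in S.  This is the
   B-submodule generated by S when B is a subring, and the product ideal when
   B and S are ideals. *)
Definition sums_of_products (R : comNzRingType) (B S : R -> Prop) (x : R)
    : Prop :=
  exists (k : nat) (a s : 'I_k -> R),
    (forall i, B (a i) /\ S (s i)) /\ x = \sum_(i < k) a i * s i.

Definition generates (R : comNzRingType) (S I : R -> Prop) : Prop :=
  forall x, I x <-> sums_of_products (fun=> True) S x.

Fixpoint ideal_pow (R : comNzRingType) (I : R -> Prop) (n : nat) : R -> Prop :=
  if n is m.+1 then sums_of_products I (ideal_pow I m) else fun=> True.

(* P is an associated prime of R / I: the annihilator of some class f + I. *)
Definition associated_prime (R : comNzRingType) (I P : R -> Prop) : Prop :=
  is_prime P /\ exists f, forall a, P a <-> I (a * f).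

(* R_P, as a subring of the fraction field of the domain R. *)
Definition localization (R : idomainType) (P : R -> Prop)
    (x : {fraction R}) : Prop :=
  exists a s : R, ~ P s /\ x = tofrac a / tofrac s.

(* J R_P, the ideal of R_P generated by the image of J. *)
Definition extension (R : idomainType) (P J : R -> Prop)
    : {fraction R} -> Prop :=
  sums_of_products (localization P)
    (fun x => exists2 a, J a & x = tofrac a).

Definition symbolic_power (R : idomainType) (I : R -> Prop) (n : nat) (f : R)
    : Prop :=
  forall P : R -> Prop, associated_prime I P ->
    extension P (ideal_pow I n) (tofrac f).

Definition homogeneous_ideal (K : fieldType) (r : nat)
    (I : {mpoly K[r]} -> Prop) : Prop :=
  is_ideal I /\ forall f d, I f -> I (pihomog mdeg d f).

(* msize f is deg f + 1 for f != 0 and msize 0 is 0, so the zero polynomial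
   has degree smaller than every natural number, and deg f < d is
   msize f <= d. *)
Definition generated_in_degrees_lt (K : fieldType) (r : nat) (d : nat)
    (I : {mpoly K[r]} -> Prop) : Prop :=
  exists S : {mpoly K[r]} -> Prop,
    (forall f, S f -> (msize f <= d)%N) /\ generates S I.

Definition generated_in_degrees_le (K : fieldType) (r : nat) (d : nat)
    (I : {mpoly K[r]} -> Prop) : Prop :=
  exists S : {mpoly K[r]} -> Prop,
    (forall f, S f -> (msize f <= d.+1)%N) /\ generates S I.

(* Main.v *)
Require Import Defs.
From HB Require Import structures.
From mathcomp Require Import all_boot all_order all_algebra.
From mathcomp.algebra Require Import fraction.
From mathcomp.multinomials Require Import mpoly.
From mathcomp Require Import zify.
From Stdlib Require Import Classical.

(** If [I] is nonzero, write [I = f J] with [f] a form of maximal degree [d]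
    dividing all of [I].  Unique factorization gives [I^(n) = f^n J^(n)] and
    two coprime forms in [J], so that the Hilbert function of [A/J] is bounded.
    As [J] is radical, boundedness yields a form [l] of positive degree that is
    a nonzerodivisor modulo [J] (unless [J] contains every form of positive
    degree) and then [A_t = J_t + l A_(t-c)] for [t >= s].  Since [J] is
    generated in degrees [<= D - d], iterating gives
    [A_t = (J^n)_t + l A_(t-c)] for [t >= T := s + n (D - d)].  The form [l] is
    also a nonzerodivisor modulo the homogeneous ideal [J^(n)], which contains
    [J^n], and a graded Nakayama argument shows that [J^(n)] is generated in
    degrees [<= T].  Hence [I^(n)] is generated in degrees [<= n D + s]. *)

Set Implicit Arguments.
Unset Strict Implicit.
Unset Printing Implicit Defensive.

Import GRing.Theory.
Local Open Scope ring_scope.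

(** * Unique factorization *)

(** Over a finite field every linear form may be a zero divisor modulo [J], as for the ideal of all
    rational points of the plane. Hence [l] has some degree [c], and regular or coprime forms are
    built by adding powers whose exponents equalize the degrees, never by choosing scalars. The
    factor [f] has to go because coprime forms exist in an ideal only if no prime form divides all
    of it. Three variables enter only through the Hilbert function: two coprime ternary forms of
    degrees [d] and [e] leave at most [d * e] dimensions in each large degree. No primary
    decomposition is needed, since a nonzerodivisor modulo [J] lies outside every associated prime.
    What makes the bound work is that [s] does not depend on [n]: [n * D + s] is less than
    [(D + 1) * n] once [n] exceeds [s]. *)

Definition divides (R : comNzRingType) (a b : R) : Prop :=
  exists c, b = c * a.

Definition prime_elt (R : idomainType) (p : R) : Prop :=
  [/\ p != 0, p \isn't a GRing.unit &
      forall a b, divides p (a * b) -> divides p a \/ divides p b].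

Definition factorization (R : idomainType) (a u : R) (ps : seq R) : Prop :=
  [/\ u \is a GRing.unit, (forall p, p \in ps -> prime_elt p) &
      a = u * \prod_(p <- ps) p].

Definition has_factorization (R : idomainType) (a : R) : Prop :=
  exists u ps, factorization a u ps.

Definition factorial_domain (R : idomainType) : Prop :=
  forall a : R, a != 0 -> has_factorization a.

Lemma divides_mull (R : comNzRingType) (a b c : R) :
  divides a b -> divides a (c * b).
Proof. by case=> d ->; exists (c * d); rewrite mulrA. Qed.

Lemma divides_mulr (R : comNzRingType) (a b c : R) :
  divides a b -> divides a (b * c).
Proof. by rewrite mulrC; apply: divides_mull. Qed.

Lemma dividesxx (R : comNzRingType) (a : R) : divides a a.
Proof. by exists 1; rewrite mul1r. Qed.

Lemma dividesD (R : comNzRingType) (a b c : R) :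
  divides a b -> divides a c -> divides a (b + c).
Proof. by case=> x -> [y ->]; exists (x + y); rewrite mulrDl. Qed.

Lemma dividesB (R : comNzRingType) (a b c : R) :
  divides a b -> divides a c -> divides a (b - c).
Proof. by case=> x -> [y ->]; exists (x - y); rewrite mulrBl. Qed.

Lemma has_factorization_mul (R : idomainType) (a b : R) :
  has_factorization a -> has_factorization b -> has_factorization (a * b).
Proof.
case=> u [ps [uu pps ->]] [v [qs [uv pqs ->]]]; exists (u * v), (ps ++ qs).
split; first by rewrite unitrM uu.
  by move=> p; rewrite mem_cat => /orP[/pps|/pqs].
by rewrite big_cat /= mulrACA.
Qed.

(** Each prime of [ps] divides [a] or [b] and is cancelled from that factor, so [ps] is distributed
    between the two. The equation of sizes lets the number of primes serve as an induction
    measure. *)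
Lemma factorization_split (R : idomainType) (ps : seq R) (a b u : R) :
  factorization (a * b) u ps ->
  exists v qs w rs, [/\ factorization a v qs, factorization b w rs &
     (size qs + size rs)%N = size ps].
Proof.
elim: ps a b u => [|p ps IH] a b u [uu pps].
  rewrite big_nil mulr1 => abu.
  move: uu; rewrite -abu unitrM => /andP[ua ub].
  exists a, [::], b, [::]; split => //; split => //; by rewrite big_nil mulr1.
have [p0 pU pP] := pps p (mem_head _ _).
have pps' q : q \in ps -> prime_elt q by move=> qs; apply: pps; rewrite inE qs orbT.
rewrite big_cons mulrCA => ab.
have /pP [[c ac]|[c bc]] : divides p (a * b) by exists (u * \prod_(j <- ps) j); rewrite ab mulrC.
  have /IH [v [qs [w [rs [[uv qsP cE] fb sz]]]]] : factorization (c * b) u ps.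
    by split => //; apply: (mulfI p0); rewrite -ab ac mulrA [p * c]mulrC.
  exists v, (p :: qs), w, rs; split => //; last by rewrite /= addSn sz.
  split => //; first by move=> q; rewrite inE => /orP[/eqP ->|/qsP //]; split.
  by rewrite ac cE big_cons [p * _]mulrC mulrA.
have /IH [v [qs [w [rs [fa [uw rsP cE] sz]]]]] : factorization (a * c) u ps.
  by split => //; apply: (mulfI p0); rewrite -ab bc mulrCA [p * c]mulrC.
exists v, qs, w, (p :: rs); split => //; last by rewrite /= addnS sz.
split => //; first by move=> q; rewrite inE => /orP[/eqP ->|/rsP //]; split.
by rewrite bc cE big_cons [p * _]mulrC mulrA.
Qed.

Lemma has_factorization_factorr (R : idomainType) (a b : R) :
  has_factorization (a * b) -> has_factorization b.
Proof.
by case=> u [ps /factorization_split [v [qs [w [rs [_ fb _]]]]]]; exists w, rs.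
Qed.

Lemma prime_elt_divides_prod (R : idomainType) (p : R) (s : seq R) :
  prime_elt p -> divides p (\prod_(q <- s) q) -> exists2 q, q \in s & divides p q.
Proof.
move=> [p0 pU pP]; elim: s => [|q s IH].
  by rewrite big_nil => -[c c1]; case/negP: pU; apply/unitrPr; exists c; rewrite mulrC.
rewrite big_cons => /pP [pq|/IH [r rs pr]]; first by exists q; rewrite ?mem_head.
by exists r; rewrite // inE rs orbT.
Qed.

Lemma prime_elt_ndivides_unit (R : idomainType) (p u : R) :
  prime_elt p -> u \is a GRing.unit -> ~ divides p u.
Proof.
move=> [_ pU _] uu [c uc]; move: uu; rewrite uc unitrM => /andP[_ pu].
by rewrite pu in pU.
Qed.

Lemma prime_elt_divides_exp (R : idomainType) (p a : R) k :
  prime_elt p -> divides p (a ^+ k) -> divides p a.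
Proof.
move=> pp; elim: k => [|k IH].
  by rewrite expr0 => /(prime_elt_ndivides_unit pp (unitr1 _)).
by rewrite exprS; have [_ _ pP] := pp; case/pP.
Qed.

(* Localizing at each prime factor of [g] is enough to detect divisibility by
   [g]. *)
Lemma divides_local (R : idomainType) (g v u : R) (ps : seq R) :
  factorization g u ps ->
  (forall p, p \in ps -> exists2 s, ~ divides p s & divides g (s * v)) ->
  divides g v.
Proof.
elim: ps g v => [|p ps IH] g v [uu pps gE] H.
  by exists (v / u); rewrite gE big_nil mulr1 divrK.
have pp := pps p (mem_head _ _).
have [p0 pU pP] := pp.
have [s ps' [c scg]] := H p (mem_head _ _).
pose g' := u * \prod_(q <- ps) q.
have gE' : g = g' * p by rewrite gE big_cons mulrCA mulrC.
have [/ps' //|[v' vE]] : divides p s \/ divides p v.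
  by apply: pP; exists (c * g'); rewrite scg gE' mulrA.
have [d v'd] : divides g' v'.
  apply: IH; first by split => // q qps; apply: pps; rewrite inE qps orbT.
  move=> q qps; have [|t qt [d td]] := H q; first by rewrite inE qps orbT.
  exists t => //; exists d; apply: (mulIf p0).
  by rewrite -mulrA -vE td gE' mulrA.
by exists d; rewrite gE' mulrA -v'd -vE.
Qed.

(** * Gauss's lemma and polynomials over a factorial domain *)

Lemma divides_polyC (R : comNzRingType) (p : R) (f : {poly R}) :
  divides p%:P f <-> forall i, divides p f`_i.
Proof.
split=> [[q ->] i|]; first by exists q`_i; rewrite coefMC.
elim/poly_ind: f => [|f c IH] H; first by exists 0; rewrite mul0r.
have [d cd] := H 0; rewrite coefD coefMX coefC /= add0r in cd.
have /IH [q fq] : forall i, divides p f`_i.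
  by move=> i; move: (H i.+1); rewrite coefD coefMX coefC /= addr0.
by exists (q * 'X + d%:P); rewrite mulrDl -polyCM -cd {1}fq mulrAC.
Qed.

(** If [p] divides [f * g], it divides one of the two constant coefficients, by symmetry that of
    [f]. Dropping this coefficient and cancelling 'X gives a smaller product that [p] still
    divides. *)
Lemma prime_elt_polyC (R : idomainType) (p : R) :
  prime_elt p -> prime_elt p%:P.
Proof.
move=> [p0 pU pP]; split; first by rewrite polyC_eq0.
  rewrite poly_unitE coefC eqxx; apply/negP => /andP[_ up].
  by rewrite up in pU.
move=> f g; have [n] := ubnP (size f + size g).
elim: n f g => // n IH f g.
wlog pf0 : f g / divides p f`_0.
  move=> wl sz D; have : divides p (f`_0 * g`_0).
    by move/divides_polyC/(_ 0%N): D; rewrite coefM big_ord1.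
  case/pP => [pf|pg]; first exact: wl.
  by rewrite or_comm; apply: wl; rewrite ?[g * f]mulrC // addnC.
elim/poly_ind: f pf0 => [|f c _] pf0 sz D.
  by left; exists 0; rewrite mul0r.
have pc : divides p c by move: pf0; rewrite coefD coefMX coefC /= add0r.
have pcP : divides p%:P c%:P by case: pc => d ->; exists d%:P; rewrite polyCM.
have [->|f0] := eqVneq f 0; first by left; rewrite mul0r add0r.
have /IH : divides p%:P (f * g).
  have : divides p%:P ('X * (f * g)).
    have -> : 'X * (f * g) = (f * 'X + c%:P) * g - c%:P * g.
      by rewrite mulrDl addrK mulrA ['X * _]mulrC.
    by apply: dividesB => //; apply: divides_mulr.
  move/divides_polyC => E; apply/divides_polyC => i.
  by move: (E i.+1); rewrite mulrC coefMX.
case; last by right.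
  by move: sz; rewrite size_MXaddC (negbTE f0) /= addSn ltnS.
by move=> pf; left; apply: dividesD => //; apply: divides_mulr.
Qed.

(** The predicates [%|] and [irreducible_poly] see polynomials only up to nonzero constants of [R].
    As [f] has no constant prime factor, pseudo-divisibility by [f] is genuine divisibility, and the
    usual gcd argument applies. *)
Lemma prime_elt_irreducible (R : idomainType) (f : {poly R}) :
  factorial_domain R ->
  (forall p, prime_elt p -> ~ divides p%:P f) ->
  irreducible_poly f -> prime_elt f.
Proof.
move=> ufd prim [sf irr].
have f0 : f != 0 by rewrite -size_poly_gt0 ltnW.
split => //.
  by rewrite poly_unitE; apply/negP => /andP[/eqP s1]; rewrite s1 in sf.
(* The primes of [c] are cancelled one at a time: each stays prime in [{poly R}] and does not divide
   [f], so it divides the cofactor. *)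
have pseudo g : f %| g -> divides f g.
  case/Pdiv.Idomain.dvdpP => -[c q] /= c0 cg.
  have [u [ps]] := ufd c c0.
  elim: ps c c0 q cg => [|p ps IH] c c0 q cg [uu pps cE].
    rewrite big_nil mulr1 in cE; exists (c^-1 *: q).
    by rewrite -scalerAl -cg scalerA mulVr ?scale1r // cE.
  have pp := pps p (mem_head _ _); have [p0 _ _] := pp.
  pose c' := u * \prod_(q <- ps) q.
  have cE' : c = p * c' by rewrite cE big_cons mulrCA.
  have [[q' qE]|/(prim _ pp) //] : divides p%:P q \/ divides p%:P f.
    have [_ _ H] := prime_elt_polyC pp; apply: H.
    by exists (c' *: g); rewrite -cg cE' -scalerA mulrC mul_polyC.
  apply: (IH c' _ q').
  - by apply: contraNneq c0; rewrite cE' => ->; rewrite mulr0.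
  - apply: (@mulfI _ p%:P); first by rewrite polyC_eq0.
    by rewrite mul_polyC scalerA -cE' cg qE mulrCA mulrA.
  - by split => // r rps; apply: pps; rewrite inE rps orbT.
move=> a b [c abc].
have fab : f %| a * b by rewrite abc dvdp_mulIr.
case: (boolP (coprimep f a)) => [cop|].
  by right; apply: pseudo; rewrite -(Gauss_dvdpr _ cop).
rewrite /coprimep => sg; left; apply: pseudo.
have := irr _ sg (dvdp_gcdl _ _); rewrite /eqp => /andP[_ fg].
exact: dvdp_trans fg (dvdp_gcdr _ _).
Qed.

(** Nested induction on the size of [f] and on the number of primes in its leading coefficient,
    which drops when a constant prime is divided out. Without such primes, a reducible [f] splits
    only after multiplication by a constant [c]; a factorization of [c *: f] is then handed down to
    its factor [f]. *)
Lemma factorial_domain_poly (R : idomainType) :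
  factorial_domain R -> factorial_domain {poly R}.
Proof.
move=> ufd f f0; have [n] := ubnP (size f); elim: n f f0 => // n IHn f f0.
have lf0 : lead_coef f != 0 by rewrite lead_coef_eq0.
have [u [ps]] := ufd _ lf0; have [k] := ubnP (size ps).
elim: k f f0 lf0 u ps => // k IHk f f0 lf0 u ps szps fact szf.
case: (classic (exists2 p, prime_elt p & divides p%:P f)) => [[p pp [g fg]]|prim].
  have [p0 pU _] := pp.
  have g0 : g != 0 by apply: contraNneq f0 => g0; rewrite fg g0 mul0r.
  have lfg : lead_coef f = p * lead_coef g.
    by rewrite fg lead_coefM lead_coefC mulrC.
  rewrite lfg in fact.
  have [v [qs [w [rs [[uv _ pE] fb sz]]]]] := factorization_split fact.
  rewrite fg; apply: has_factorization_mul; last first.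
    exists 1, [:: p%:P]; split; rewrite ?unitr1 ?big_seq1 ?mul1r //.
    by move=> q; rewrite inE => /eqP ->; apply: prime_elt_polyC.
  apply: (IHk g g0 _ w rs) => //; first by rewrite lead_coef_eq0.
    (* A prime is not a unit, so [qs] is nonempty and [rs] is shorter than [ps]. *)
    case: qs pE sz => [|q qs] pE sz.
      by rewrite big_nil mulr1 in pE; rewrite pE uv in pU.
    by move: szps; rewrite -sz /= addSn !ltnS; apply: leq_trans; rewrite ltnS leq_addl.
  by move: szf; rewrite fg mulrC mul_polyC size_scale.
have primf p : prime_elt p -> ~ divides p%:P f by move=> pp D; apply: prim; exists p.
have [sf1|sf1] := leqP (size f) 1.
  have fE := size1_polyC sf1.
  have c0 : f`_0 != 0 by rewrite fE polyC_eq0 in f0.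
  have fu : f`_0 \is a GRing.unit.
    have [v [[|p qs] [uv pqs E]]] := ufd _ c0.
      by rewrite E big_nil mulr1.
    case: (primf p); first exact/pqs/mem_head.
    exists (v * \prod_(j <- qs) j)%:P.
    by rewrite fE E big_cons -polyCM [p * _]mulrC mulrA.
  exists f, [::]; split => //; last by rewrite big_nil mulr1.
  by rewrite fE poly_unitE coefC /= fu size_polyC c0.
case: (classic (irreducible_poly f)) => [irr|red].
  exists 1, [:: f]; split; rewrite ?unitr1 ?big_seq1 ?mul1r //.
  by move=> q; rewrite inE => /eqP ->; apply: prime_elt_irreducible.
have [g [sg gf gnf]] : exists g : {poly R}, [/\ size g != 1, g %| f & ~~ (g %= f)].
  apply: NNPP => N; apply: red; split => // g sg gf.
  by apply/negPn/negP => gnf; apply: N; exists g.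
case/Pdiv.Idomain.dvdpP: (gf) => -[c h] /= c0 cf.
have cf0 : c *: f != 0 by rewrite -mul_polyC mulf_neq0 ?polyC_eq0.
have h0 : h != 0 by apply: contraNneq cf0 => h0; rewrite cf h0 mul0r.
have g0 : g != 0 by apply: contraNneq cf0 => g0; rewrite cf g0 mulr0.
have szgf : (size g < size f)%N.
  rewrite ltn_neqAle; move: gnf; rewrite -dvdp_size_eqp // => ->.
  exact: dvdp_leq.
have szE : size f = (size h + size g)%N.-1 by rewrite -(size_scale _ c0) cf size_mul.
have szhf : (size h < size f)%N.
  rewrite szE; move: sg g0; rewrite -size_poly_gt0.
  by case: (size g) => [|[|m]] // _ _; rewrite addnS /= addnS ltnS leq_addr.
apply: (@has_factorization_factorr _ c%:P).
rewrite mul_polyC cf; apply: has_factorization_mul; apply: IHn => //.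
  exact: leq_trans szhf szf.
exact: leq_trans szgf szf.
Qed.

(** * Transport of unique factorization to several variables *)

Lemma prime_elt_bij (R S : idomainType) (phi : {rmorphism R -> S})
    (psi : S -> R) (p : S) :
  cancel phi psi -> cancel psi phi -> prime_elt p -> prime_elt (psi p).
Proof.
move=> K1 K2 [p0 pU pP]; split.
- by apply: contraNneq p0 => E; rewrite -(K2 p) E rmorph0.
- by apply: contraNN pU => U; rewrite -(K2 p); apply: rmorph_unit.
have dv a : divides p (phi a) -> divides (psi p) a.
  case=> c E; exists (psi c); apply: (can_inj K1).
  by rewrite rmorphM !K2.
move=> a b [c abc]; have : divides p (phi a * phi b).
  by exists (phi c); rewrite -rmorphM abc rmorphM K2.
by case/pP => /dv; [left|right].
Qed.

Lemma factorial_domain_bij (R S : idomainType) (phi : {rmorphism R -> S})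
    (psi : S -> R) :
  cancel phi psi -> cancel psi phi -> factorial_domain S -> factorial_domain R.
Proof.
move=> K1 K2 ufd a a0.
have pa0 : phi a != 0 by apply: contraNneq a0 => E; rewrite -(K1 a) E -(rmorph0 phi) K1.
have [u [ps [uu pps E]]] := ufd _ pa0.
exists (psi u), (map psi ps); split.
- have [v uv] := unitrPr uu.
  apply/unitrPr; exists (psi v); apply: (can_inj K1).
  by rewrite rmorphM !K2 rmorph1.
- by move=> p /mapP[q /pps qq ->]; apply: (prime_elt_bij K1).
apply: (can_inj K1); rewrite E rmorphM K2 big_map rmorph_prod; congr (_ * _).
by apply: eq_bigr => p _; rewrite K2.
Qed.

Definition muni_inv (n : nat) (R : idomainType) (q : {poly {mpoly R[n]}}) :
  {mpoly R[n.+1]} := (map_poly (@mwiden n R) q).['X_ord_max].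

Lemma muni_widenX (n : nat) (R : idomainType) (i : 'I_n) :
  muni ('X_(widen_ord (leqnSn n) i) : {mpoly R[n.+1]}) = ('X_i)%:P.
Proof.
rewrite muniE msuppX big_seq1 mcoeffX eqxx scale1r mnm1E.
have -> : (widen_ord (leqnSn n) i == ord_max) = false.
  by apply/negbTE; rewrite -val_eqE /= neq_ltn ltn_ord.
rewrite expr0 alg_polyC; congr ('X_[_])%:P; apply/mnmP => j.
by rewrite !mnmE -!val_eqE.
Qed.

Lemma muni_max (n : nat) (R : idomainType) :
  muni ('X_ord_max : {mpoly R[n.+1]}) = 'X.
Proof.
rewrite muniE msuppX big_seq1 mcoeffX eqxx scale1r mnm1E eqxx expr1.
rewrite (_ : [multinom _ | i < n] = 0%MM) ?mpolyX0 ?scale1r //.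
apply/mnmP => j; rewrite !mnmE -val_eqE /= gtn_eqF //.
Qed.

Lemma muni_inv_is_additive (n : nat) (R : idomainType) : additive (@muni_inv n R).
Proof. by move=> p q; rewrite /muni_inv rmorphB hornerD hornerN. Qed.

Lemma muni_inv_is_multiplicative (n : nat) (R : idomainType) :
  multiplicative (@muni_inv n R).
Proof.
split=> [p q|]; first by rewrite /muni_inv rmorphM hornerM.
by rewrite /muni_inv rmorph1 hornerC.
Qed.

HB.instance Definition _ (n : nat) (R : idomainType) :=
  GRing.isAdditive.Build _ _ (@muni_inv n R) (@muni_inv_is_additive n R).
HB.instance Definition _ (n : nat) (R : idomainType) :=
  GRing.isMultiplicative.Build _ _ (@muni_inv n R)
    (@muni_inv_is_multiplicative n R).

Lemma muni_invC (n : nat) (R : idomainType) (c : {mpoly R[n]}) :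
  muni_inv c%:P = mwiden c.
Proof. by rewrite /muni_inv map_polyC hornerC. Qed.

Lemma muni_invX (n : nat) (R : idomainType) :
  muni_inv ('X : {poly {mpoly R[n]}}) = 'X_ord_max.
Proof. by rewrite /muni_inv map_polyX hornerX. Qed.

Lemma muniK (n : nat) (R : idomainType) : cancel (@muni n R) (@muni_inv n R).
Proof.
elim/mpolyind => [|c m p _ _ IH]; first by rewrite !rmorph0.
rewrite muniD (rmorphD (@muni_inv n R)) [X in _ + X]IH; congr (_ + _).
rewrite -mul_mpolyC mpolyXE_id !rmorphM !rmorph_prod /=; congr (_ * _).
  by rewrite muniC muni_invC mwidenC.
apply: eq_bigr => i _; rewrite !rmorphXn /=; congr (_ ^+ _).
have [->|] := eqVneq i ord_max; first by rewrite muni_max muni_invX.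
case: (unliftP ord_max i) => [j ->|->]; last by rewrite eqxx.
move=> _; have -> : lift ord_max j = widen_ord (leqnSn n) j.
  by apply/val_inj; rewrite /= /bump leqNgt ltn_ord.
by rewrite muni_widenX muni_invC mwidenX mnmwiden1.
Qed.

Lemma muni_mwiden (n : nat) (R : idomainType) (p : {mpoly R[n]}) :
  muni (mwiden p) = p%:P.
Proof.
elim/mpolyind: p => [|c m p _ _ IH]; first by rewrite !raddf0.
rewrite !raddfD /= {}IH; congr (_ + _).
rewrite -mul_mpolyC mpolyXE_id !rmorphM !rmorph_prod /= mwidenC muniC; congr (_ * _).
apply: eq_bigr => i _; rewrite !rmorphXn /=; congr (_ ^+ _).
by rewrite mwidenX mnmwiden1 muni_widenX.
Qed.

Lemma muni_invK (n : nat) (R : idomainType) : cancel (@muni_inv n R) (@muni n R).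
Proof.
elim/poly_ind => [|q c IH]; first by rewrite !rmorph0.
by rewrite !rmorphD !rmorphM /= IH muni_invX muni_invC muni_max muni_mwiden.
Qed.

Lemma factorial_domain_mpoly (K : fieldType) (n : nat) :
  factorial_domain {mpoly K[n]}.
Proof.
elim: n => [|n IH].
  move=> p p0; exists p, [::]; split => //; last by rewrite big_nil mulr1.
  have pE : p = (p@_0%MM)%:MP.
    by apply/mpolyP => m; rewrite (_ : m = 0%MM) ?mcoeffC ?eqxx ?mulr1 //; apply/mnmP => -[].
  rewrite pE; apply: (rmorph_unit (@mpolyC 0 K)).
  by rewrite unitfE; apply: contraNneq p0 => c0; rewrite pE c0.
exact: (@factorial_domain_bij _ _ (@muni n K) _ (@muniK n K) (@muni_invK n K) (factorial_domain_poly IH)).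
Qed.

(** * Powers and symbolic powers of ideals *)

Lemma sums_of_products_ind (R : comNzRingType) (B S T : R -> Prop) :
  T 0 -> (forall a b, T a -> T b -> T (a + b)) ->
  (forall b s, B b -> S s -> T (b * s)) ->
  forall x, sums_of_products B S x -> T x.
Proof.
move=> T0 TD TM x [k [a [s [H ->]]]].
by apply: big_ind => // i _; case: (H i) => ? ?; apply: TM.
Qed.

Lemma sums_of_products0 (R : comNzRingType) (B S : R -> Prop) :
  sums_of_products B S 0.
Proof.
exists 0%N, (fun _ => 0), (fun _ => 0); split; first by case.
by rewrite big_ord0.
Qed.

Lemma sums_of_productsD (R : comNzRingType) (B S : R -> Prop) (x y : R) :
  sums_of_products B S x -> sums_of_products B S y ->
  sums_of_products B S (x + y).
Proof.
case=> k [a [s [H ->]]] [l [b [t [H' ->]]]].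
pose c (i : 'I_(k + l)) := match split i with inl i => a i | inr i => b i end.
pose r (i : 'I_(k + l)) := match split i with inl i => s i | inr i => t i end.
exists (k + l)%N, c, r; split; first by rewrite /c /r => i; case: splitP.
rewrite big_split_ord /=; congr (_ + _); apply: eq_bigr => i _; rewrite /c /r.
  by rewrite (unsplitK (inl i)).
by rewrite (unsplitK (inr i)).
Qed.

Lemma sums_of_productsM (R : comNzRingType) (B S : R -> Prop) (b s : R) :
  B b -> S s -> sums_of_products B S (b * s).
Proof.
by exists 1%N, (fun _ => b), (fun _ => s); split=> //; rewrite big_ord1.
Qed.

Lemma sums_of_products_ideal (R : comNzRingType) (B S : R -> Prop) :
  (forall c b, B b -> B (c * b)) -> is_ideal (sums_of_products B S).
Proof.
move=> HB; split; [exact: sums_of_products0|exact: sums_of_productsD|].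
move=> c; apply: sums_of_products_ind.
- by rewrite mulr0; apply: sums_of_products0.
- by move=> a b; rewrite mulrDr; apply: sums_of_productsD.
by move=> b s Bb Ss; rewrite mulrA; apply: sums_of_productsM => //; apply: HB.
Qed.

Lemma generated_sub (R : comNzRingType) (S I : R -> Prop) (x : R) :
  is_ideal I -> (forall s, S s -> I s) -> sums_of_products (fun=> True) S x -> I x.
Proof.
by move=> [I0 ID IM] SI; move: x; apply: sums_of_products_ind => // b s _ /SI; apply: IM.
Qed.

Lemma ideal_pow_ideal (R : comNzRingType) (I : R -> Prop) n :
  is_ideal I -> is_ideal (ideal_pow I n).
Proof.
move=> [I0 ID IM]; case: n => [|n] /=; first by split.
by apply: sums_of_products_ideal.
Qed.

Lemma ideal_powS (R : comNzRingType) (I : R -> Prop) n x y :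
  I x -> ideal_pow I n y -> ideal_pow I n.+1 (x * y).
Proof. exact: sums_of_productsM. Qed.

Lemma ideal_pow_exp (R : comNzRingType) (I : R -> Prop) n x :
  I x -> ideal_pow I n (x ^+ n).
Proof. by move=> Ix; elim: n => // n IH; rewrite exprS; apply: ideal_powS. Qed.

(** Together with [ideal_pow_preimage] this says that the [n]-th power of [f J] is [f ^+ n] times
    that of [J]. *)
Lemma ideal_pow_image (R : comNzRingType) (I J : R -> Prop) (f y : R) n :
  (forall x, J x -> I (f * x)) -> ideal_pow J n y -> ideal_pow I n (f ^+ n * y).
Proof.
move=> JI; elim: n y => // n IH; apply: sums_of_products_ind.
- by rewrite mulr0; apply: sums_of_products0.
- by move=> a b; rewrite mulrDr; apply: sums_of_productsD.
move=> b s Jb Js; rewrite exprS mulrACA; apply: ideal_powS; first exact: JI.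
exact: IH.
Qed.

Lemma ideal_pow_preimage (R : comNzRingType) (I J : R -> Prop) (f x : R) n :
  (forall x, I x -> exists2 y, J y & x = f * y) -> ideal_pow I n x ->
  exists2 y, ideal_pow J n y & x = f ^+ n * y.
Proof.
move=> IJ; elim: n x => [|n IH] x; first by exists x; rewrite // mul1r.
move: x; apply: sums_of_products_ind.
- by exists 0; rewrite ?mulr0 //; apply: sums_of_products0.
- move=> _ _ [a Ja ->] [b Jb ->]; exists (a + b); last by rewrite mulrDr.
  exact: sums_of_productsD.
move=> b s /IJ [b' Jb ->] /IH [s' Js ->]; exists (b' * s').
  exact: ideal_powS.
by rewrite exprS mulrACA.
Qed.

(** Since [P] is prime, the summands have a common denominator outside [P]. This moves symbolic
    powers from the fraction field into [R]. *)
Lemma extension_tofrac (R : idomainType) (P Q : R -> Prop) (u : R) :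
  is_prime P -> is_ideal Q ->
  extension P Q (tofrac u) <-> exists2 s, ~ P s & Q (s * u).
Proof.
move=> [[P0 _ _] P1 Pp] [Q0 QD QM].
have nz s : ~ P s -> tofrac s != 0.
  by move=> Ps; rewrite tofrac_eq0; apply/eqP => s0; apply: Ps; rewrite s0.
split=> [|[s Ps Qsu]]; last first.
  have -> : tofrac u = (tofrac 1 / tofrac s) * tofrac (s * u).
    by rewrite tofracM mulrA divrK ?unitfE ?nz // tofrac1 mul1r.
  by apply: sums_of_productsM; [exists 1, s|exists (s * u)].
suff H x : extension P Q x ->
    exists s q, [/\ ~ P s, Q q & tofrac s * x = tofrac q].
  case/H => s [q [Ps Qq E]]; exists s => //.
  by move: E; rewrite -tofracM => /eqP; rewrite tofrac_eq => /eqP ->.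
move: x; apply: sums_of_products_ind.
- by exists 1, 0; rewrite mulr0 tofrac0.
- move=> x1 x2 [s [q [Ps Qq E]]] [t [r [Pt Qr F]]].
  exists (s * t), (t * q + s * r); split.
  + by case/Pp.
  + by apply: QD; apply: QM.
  by rewrite tofracD !tofracM -E -F mulrDr ![_ * (_ * x1)]mulrA ![_ * (_ * x2)]mulrA [tofrac t * _]mulrC.
move=> _ _ [a [s [Ps ->]]] [q Qq ->]; exists s, (a * q); split=> //.
  exact: QM.
by rewrite tofracM mulrA [tofrac a / _]mulrC mulVKf ?nz.
Qed.

Lemma symbolic_powerP (R : idomainType) (I : R -> Prop) n (u : R) :
  is_ideal I ->
  symbolic_power I n u <->
  (forall P, associated_prime I P -> exists2 s, ~ P s & ideal_pow I n (s * u)).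
Proof.
move=> idI; have idn := ideal_pow_ideal n idI.
split=> H P PI; have [pP _] := PI; first exact/(extension_tofrac _ pP idn)/H.
exact/(extension_tofrac _ pP idn)/H.
Qed.

Lemma symbolic_power_ideal (R : idomainType) (I : R -> Prop) n :
  is_ideal I -> is_ideal (symbolic_power I n).
Proof.
move=> idI; have [N0 ND NM] := ideal_pow_ideal n idI; split.
- apply/(symbolic_powerP _ _ idI) => P [[_ P1 _] _].
  by exists 1; rewrite // mulr0.
- move=> a b /(symbolic_powerP _ _ idI) Ha /(symbolic_powerP _ _ idI) Hb.
  apply/(symbolic_powerP _ _ idI) => P PI.
  have [s Ps Ns] := Ha P PI; have [t Pt Nt] := Hb P PI.
  have [[_ _ Pp] _] := PI.
  exists (s * t); first by case/Pp.
  by rewrite mulrDr; apply: ND; last rewrite -mulrA; first rewrite mulrAC mulrC; apply: NM.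
- move=> a b /(symbolic_powerP _ _ idI) Hb; apply/(symbolic_powerP _ _ idI) => P PI.
  by have [s Ps Ns] := Hb P PI; exists s; rewrite // mulrCA; apply: NM.
Qed.

Lemma ideal_pow_symbolic (R : idomainType) (I : R -> Prop) n (u : R) :
  is_ideal I -> ideal_pow I n u -> symbolic_power I n u.
Proof.
move=> idI Iu; apply/(symbolic_powerP _ _ idI) => P [[_ P1 _] _].
by exists 1; rewrite // mul1r.
Qed.

(** If [l] were in an associated prime, the annihilator of the class of [w], then [l * w] and hence
    [w] would be in [I]. So [s * l] is as good a denominator as [s]. *)
Lemma symbolic_power_cancel (R : idomainType) (I : R -> Prop) n (l u : R) :
  is_ideal I -> (forall a, I (a * l) -> I a) ->
  symbolic_power I n (l * u) -> symbolic_power I n u.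
Proof.
move=> idI lnz /(symbolic_powerP _ _ idI) H.
apply/(symbolic_powerP _ _ idI) => P PI; have [s Ps Is] := H P PI.
exists (s * l); last by rewrite -mulrA.
have [[_ P1 Pp] [w Pw]] := PI; case/Pp => // /Pw Ilw; apply: P1; apply/Pw.
by rewrite mul1r; apply: lnz; rewrite mulrC.
Qed.

(** Here [I] is [f J]. The associated primes of [I] that contain [J] are exactly those of [J]; at
    the others [J] becomes the unit ideal. Among the latter are the primes generated by the prime
    factors of [f], and localizing there shows that [f ^+ n] divides all of the symbolic power of
    [I]. *)
Lemma symbolic_power_factor (R : idomainType) (I J : R -> Prop) (f e : R)
    (ps : seq R) n (x : R) :
  is_ideal I -> is_ideal J -> factorization f e ps ->
  (forall y, J y <-> I (f * y)) -> (forall y, I y -> divides f y) ->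
  (forall p, p \in ps -> exists2 j, J j & ~ divides p j) ->
  symbolic_power I n x <->
  exists2 v, symbolic_power J n v & x = f ^+ n * v.
Proof.
move=> idI idJ fact JI If Jp.
have [ue pps fE] := fact.
have [I0 ID IM] := idI; have [J0 JD JM] := idJ.
have f0 : f != 0.
  rewrite fE mulf_neq0 ?prodf_seq_neq0 //; last first.
    by apply/allP => p /pps[].
  by apply: contraTneq ue => ->; rewrite unitr0.
have IJ y : I y -> exists2 z, J z & y = f * z.
  move=> Iy; have [z yz] := If y Iy; exists z; last by rewrite mulrC.
  by apply/JI; rewrite mulrC -yz.
have assJI P : associated_prime J P -> associated_prime I P.
  case=> pP [w Pw]; split=> //; exists (f * w) => a.
  by rewrite Pw mulrCA JI.
split=> [/(symbolic_powerP _ _ idI) Hx|[v /(symbolic_powerP _ _ idJ) Hv ->]]; last first.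
  apply/(symbolic_powerP _ _ idI) => P PI; have [pP [g Pg]] := PI.
  have [_ _ Pp] := pP.
  case: (classic (forall j, J j -> P j)) => [JP|/not_all_ex_not [j JPj]]; last first.
    have Jj : J j by apply: NNPP => N; apply: JPj => /N.
    have Pj : ~ P j by move=> Pj; apply: JPj.
    exists (j ^+ n); last first.
      have [_ _ HM] := ideal_pow_ideal n idI.
      rewrite mulrA mulrC [_ * f ^+ n]mulrC; apply: HM.
      by apply: (ideal_pow_image (J := J)); [move=> y /JI|apply: ideal_pow_exp].
    elim: n {Hv} => [|n IH] //; last by rewrite exprS => /Pp[].
    by rewrite expr0; case: pP.
  (* As [P] contains [J] and annihilates [g] modulo [I], each [j * g] lies in [I] and is divisible
     by [f]. The quotient [g'] then exhibits [P] as an associated prime of [J]. *)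
  have [g' gE] : divides f g.
    apply: (divides_local fact) => p pps'; have [j Jj pj] := Jp p pps'.
    by exists j => //; apply/If/Pg/JP.
  have [|s Ps Js] := Hv P.
    split=> //; exists g' => a; rewrite Pg gE JI.
    by rewrite [g' * f]mulrC mulrCA.
  exists s => //; rewrite mulrCA.
  by apply: (ideal_pow_image (J := J)) => // y /JI.
have [v xE] : divides (f ^+ n) x.
  have factn : factorization (f ^+ n) (e ^+ n) (flatten (nseq n ps)).
    split; first exact: unitrX.
      by move=> p /flattenP [_ /nseqP [-> _] /pps].
    elim: n {Hx x} => [|n IH]; first by rewrite big_nil !expr0 mulr1.
    by rewrite !exprS IH big_cat /= mulrACA -fE.
  apply: (divides_local factn) => p /flattenP [_ /nseqP [-> _] pps'].
  have pp := pps p pps'; have [p0 pU pP] := pp.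
  have [j Jj pj] := Jp p pps'.
  have [h fh] : divides p f.
    exists (e * \prod_(q <- rem p ps) q).
    by rewrite fE (perm_big _ (perm_to_rem pps')) /= big_cons mulrCA mulrC.
  (* The multiples of [p] are the annihilator of [h * j] modulo [I], so they form an associated
     prime. *)
  have [s ps' Is] : exists2 s, ~ divides p s & ideal_pow I n (s * x).
    apply: Hx; split; first split.
    - split; [by exists 0; rewrite mul0r|by move=> ? ?; apply: dividesD|].
      by move=> ? ?; apply: divides_mull.
    - exact: (prime_elt_ndivides_unit pp (unitr1 _)).
    - exact: pP.
    exists (h * j) => a; split=> [[b ->]|].
      have -> : b * p * (h * j) = f * (b * j) by rewrite fh mulrACA [RHS]mulrACA [b * h]mulrC.
      by apply/JI; apply: JM.
    case/If => c E.
    have : divides p (a * j).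
      exists c; apply: (@mulfI _ h); first by apply: contraNneq f0 => h0; rewrite fh h0 mul0r.
      by rewrite mulrCA E fh mulrCA.
    by case/pP.
  exists s => //.
  by have [y _ ->] := ideal_pow_preimage IJ Is; exists y; rewrite mulrC.
exists v; last by rewrite xE mulrC.
apply/(symbolic_powerP _ _ idJ) => P PJ.
have [s Ps Is] := Hx P (assJI P PJ); exists s => //.
have [y Jy E] := ideal_pow_preimage IJ Is.
suff -> : s * v = y by [].
apply: (mulfI (expf_neq0 n f0)); rewrite -E xE.
by rewrite [v * _]mulrC mulrCA.
Qed.

(** * Forms and homogeneous ideals *)

Lemma pihomog_geq_msize (R : idomainType) (r : nat) (p : {mpoly R[r]}) d :
  (msize p <= d)%N -> pihomog mdeg d p = 0.
Proof.
move=> pd; rewrite pihomogE big_seq_cond big_pred0 // => m.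
apply/negbTE/negP => /andP[/msize_mdeg_lt mp /eqP md].
by move: mp; rewrite md ltnNge pd.
Qed.

Lemma pihomog_sum (R : idomainType) (r : nat) (p : {mpoly R[r]}) :
  p = \sum_(d < msize p) pihomog mdeg d p.
Proof. exact: pihomog_partitionE. Qed.

Lemma pihomogM (R : idomainType) (r : nat) (a b : {mpoly R[r]}) d t :
  a \is d.-homog ->
  pihomog mdeg t (a * b) = if (d <= t)%N then a * pihomog mdeg (t - d) b else 0.
Proof.
move=> ha; rewrite {1}[b]pihomog_sum mulr_sumr raddf_sum /=.
have E (i : nat) : pihomog mdeg t (a * pihomog mdeg i b) =
    if (d + i == t)%N then a * pihomog mdeg i b else 0.
  have hab : a * pihomog mdeg i b \is (d + i).-homog by rewrite dhomogM ?pihomogP.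
  have [<-|ne] := eqVneq; first exact: pihomog_dE.
  exact: pihomog_ne0 hab.
under eq_bigr do rewrite E.
case: leqP => dt; last first.
  by rewrite big1 // => i _; rewrite gtn_eqF // (leq_trans dt) // leq_addr.
have [lt|ge] := ltnP (t - d) (msize b).
  rewrite (bigD1 (Ordinal lt)) //= subnKC // eqxx big1 ?addr0 // => i.
  rewrite -val_eqE /= => ne; case: eqP => // E'.
  by move: ne; rewrite -E' addKn eqxx.
rewrite (pihomog_geq_msize ge) mulr0 big1 // => i _.
case: eqP => // E'; have := ltn_ord i.
by rewrite ltnNge (leq_trans ge) // -E' addKn.
Qed.

Lemma pihomogMX (R : idomainType) (r : nat) (a b : {mpoly R[r]}) d e :
  a \is d.-homog -> pihomog mdeg (d + e) (a * b) = a * pihomog mdeg e b.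
Proof. by move=> ha; rewrite (pihomogM _ _ ha) leq_addr addKn. Qed.

Lemma msize_dhomog (R : idomainType) (r : nat) (p : {mpoly R[r]}) d :
  p \is d.-homog -> (msize p <= d.+1)%N.
Proof.
move=> hp; rewrite msizeE big_seq; apply: (big_ind (fun n => n <= d.+1)%N) => //.
  by move=> a b Ha Hb; rewrite geq_max Ha.
by move=> m mp; rewrite (dhomog_mf hp mp).
Qed.

Lemma dhomogS_ind (R : idomainType) (r : nat) t (Q : {mpoly R[r]} -> Prop) :
  Q 0 -> (forall a b, Q a -> Q b -> Q (a + b)) ->
  (forall i v, v \is t.-homog -> Q ('X_i * v)) ->
  forall u, u \is t.+1.-homog -> Q u.
Proof.
move=> Q0 QD QX u hu; rewrite [u]mpolyE big_seq.
apply: big_ind => // m mu; have dm : mdeg m = t.+1 := dhomog_mf hu mu.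
have [i mi] : exists i, m i != 0%N.
  apply: NNPP => N; move: dm; rewrite mdegE big1 // => i _.
  by apply/eqP/negPn/negP => mi; apply: N; exists i.
have mE : m = (U_(i) + (m - U_(i)))%MM.
  apply/mnmP => j; rewrite mnmDE mnmBE mnm1E; case: eqP => [<-|_] /=.
    by rewrite subnKC // lt0n.
  by rewrite subn0.
rewrite mE mpolyXD -mul_mpolyC mulrCA mul_mpolyC; apply: QX; apply: rpredZ.
rewrite dhomogX -eqSS -dm {2}mE mdegD mdeg1 //.
Qed.

Lemma homogeneous_ideal_pow (K : fieldType) (r : nat) (I : {mpoly K[r]} -> Prop) n :
  homogeneous_ideal I -> homogeneous_ideal (ideal_pow I n).
Proof.
move=> [idI hI]; split; first exact: ideal_pow_ideal.
move=> f d; elim: n f d => // n IH f d; move: f; apply: sums_of_products_ind.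
- by rewrite raddf0; apply: sums_of_products0.
- by move=> a b Ha Hb; rewrite raddfD; apply: sums_of_productsD.
move=> b s Ib Is; rewrite [b]pihomog_sum mulr_suml raddf_sum.
apply: (big_ind (ideal_pow I n.+1)); [exact: sums_of_products0|exact: sums_of_productsD|].
move=> i _; rewrite /= (pihomogM _ _ (pihomogP _ _ _)).
case: ifP => _; last exact: sums_of_products0.
by apply: ideal_powS; [apply: hI|apply: IH].
Qed.

(* Being killed modulo [Q] by an element outside of [P] amounts to being killed
   by a homogeneous such element: peel off top components of [s] and [u]. *)
Lemma homogeneous_localization (K : fieldType) (r : nat)
    (Q P : {mpoly K[r]} -> Prop) (s u : {mpoly K[r]}) d :
  homogeneous_ideal Q -> is_prime P -> ~ P s -> Q (s * u) ->
  exists2 s', ~ P s' & Q (s' * pihomog mdeg d u).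
Proof.
move=> [[Q0 QD QM] hQ] [[P0 PD PM] P1 Pp] Ps Qsu.
pose N v := exists2 s, ~ P s & Q (s * v) /\ exists e, s \is e.-homog.
have N0 : N 0 by exists 1; rewrite ?mulr0 //; split=> //; exists 0%N; apply: dhomog1.
have NM a b : N b -> N (a * b).
  by case=> t Pt [Qt ht]; exists t => //; split=> //; rewrite mulrCA; apply: QM.
have ND a b : N a -> N b -> N (a + b).
  case=> t Pt [Qt [e ht]] [t' Pt' [Qt' [e' ht']]]; exists (t * t').
    by case/Pp.
  split; last by exists (e + e')%N; apply: dhomogM.
  rewrite mulrDr; apply: QD; last by rewrite -mulrA; apply: QM.
  by rewrite mulrAC mulrC; apply: QM.
have NB a b : N a -> N b -> N (a - b).
  by move=> Na Nb; apply: ND => //; rewrite -mulN1r; apply: NM.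
have Nh a e : N a -> N (pihomog mdeg e a).
  case=> t Pt [Qt [e' ht]]; exists t => //; split; last by exists e'.
  by rewrite -(pihomogMX _ _ ht); apply: hQ.
have NC t e v : t \is e.-homog -> ~ P t -> N (t * v) -> N v.
  move=> ht Pt [t' Pt' [Qt' [e' ht']]]; exists (t' * t); first by case/Pp.
  by rewrite -mulrA; split=> //; exists (e' + e)%N; apply: dhomogM.
(* The offset [e] lets the inner induction hypothesis apply to the forms [st * w i], whose degrees
   are shifted by [m]. *)
have main m : forall s, (msize s <= m)%N -> ~ P s ->
    forall k e (w : nat -> {mpoly K[r]}), (forall i, w i \is (e + i).-homog) ->
    N (s * \sum_(i < k) w i) -> N (\sum_(i < k) w i).
  elim: m => [|m IHm] {s Ps Qsu} s sm Ps.
    by move: sm; rewrite leqn0 msize_poly_eq0 => /eqP s0; rewrite s0 in Ps.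
  have [st [s1 [hst sm' sE]]] : exists st s1,
      [/\ st \is m.-homog, (msize s1 <= m)%N & s = st + s1].
    exists (pihomog mdeg m s), (\sum_(d < m) pihomog mdeg d s); split.
    - exact: pihomogP.
    - apply: (big_ind (fun p => msize p <= m)%N); first by rewrite msize0.
        by move=> a b Ha Hb /=; apply: (leq_trans (msizeD_le _ _)); rewrite geq_max Ha.
      by move=> i _; apply: leq_trans (msize_dhomog (pihomogP _ _ _)) _.
    by rewrite [LHS](pihomog_partitionE sm) big_ord_recr /= addrC.
  elim=> [|k IHk] e w hw Ns; first by rewrite big_ord0.
  have Ntop : N (st * w k).
    suff -> : st * w k = pihomog mdeg (m + (e + k)) (s * \sum_(i < k.+1) w i).
      exact: Nh.
    rewrite sE mulrDl raddfD /= !mulr_sumr !raddf_sum /=.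
    rewrite [X in _ + X]big1 => [|i _]; last first.
      rewrite mulrC (pihomogM _ _ (hw i)); case: ifP => // _.
      rewrite pihomog_geq_msize ?mulr0 //; apply: leq_trans sm' _.
      rewrite -addnBA ?leq_addr // leq_add2l -ltnS; exact: ltn_ord.
    rewrite addr0 big_ord_recr /= pihomog_dE ?dhomogM // big1 ?add0r // => i _.
    apply: (@pihomog_ne0 _ _ _ (m + (e + i))); last exact: dhomogM.
    by rewrite !eqn_add2l ltn_eqF.
  rewrite big_ord_recr /= in Ns *.
  case: (classic (P st)) => [Pst|Pst]; last first.
    have Nk := NC _ _ _ hst Pst Ntop; apply: ND => //; apply: (IHk e) => //.
    by move: (NB _ _ Ns (NM s _ Nk)); rewrite mulrDr addrK.
  have NstW : N (st * \sum_(i < k) w i).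
    rewrite mulr_sumr; apply: (IHk (m + e)%N (fun i => st * w i)) => [i|].
      by rewrite -addnA dhomogM.
    rewrite -mulr_sumr mulrCA.
    by move: (NB _ _ (NM st _ Ns) (NM s _ Ntop)); rewrite mulrDr mulrDr [st * (s * w k)]mulrCA addrK.
  have Ns' : ~ P s1 by move=> H; apply: Ps; rewrite sE; apply: PD.
  have := IHm _ sm' Ns' k.+1 e w hw; rewrite big_ord_recr /=; apply.
  have -> : s1 = s - st by rewrite sE addrAC subrr add0r.
  by rewrite mulrBl; apply: NB => //; rewrite mulrDr; apply: ND.
have [t Pt [Qt [e ht]]] : N u.
- rewrite [u]pihomog_sum.
  apply: (main _ s (leqnn _) Ps _ 0%N (fun i => pihomog mdeg i u)).
    by move=> i; apply: pihomogP.
  rewrite -pihomog_sum; exists 1 => //; rewrite mul1r; split=> //.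
  by exists 0%N; apply: dhomog1.
by exists t => //; rewrite -(pihomogMX _ _ ht); apply: hQ.
Qed.

Lemma symbolic_power_homogeneous (K : fieldType) (r : nat)
    (I : {mpoly K[r]} -> Prop) n :
  homogeneous_ideal I -> homogeneous_ideal (symbolic_power I n).
Proof.
move=> hI; have [idI _] := hI; split; first exact: symbolic_power_ideal.
move=> f d /(symbolic_powerP _ _ idI) H; apply/(symbolic_powerP _ _ idI) => P PI.
have [s Ps Is] := H P PI; have [pP _] := PI.
exact: homogeneous_localization (homogeneous_ideal_pow n hI) pP Ps Is.
Qed.

(** Surjectivity of multiplication by [l] modulo [Q], onto every degree from [s] on. It is applied
    with [c <= s], where the truncated [t - c] is a true difference. *)
Definition covers_mod (K : fieldType) (r : nat) (Q : {mpoly K[r]} -> Prop)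
    (l : {mpoly K[r]}) (c s : nat) : Prop :=
  forall t u, (s <= t)%N -> u \is t.-homog ->
  exists y h, [/\ Q y, h \is (t - c).-homog & u = y + l * h].

Definition generated_by_forms (K : fieldType) (r : nat) (D : nat)
    (I : {mpoly K[r]} -> Prop) : Prop :=
  forall x, I x -> sums_of_products (fun=> True)
    (fun s => I s /\ exists2 d, (d <= D)%N & s \is d.-homog) x.

(** Each factor from [J] costs at most [D] degrees: a generator of degree [d <= D] is split off, and
    its cofactor of degree [t - d] is covered modulo the previous power. The constant [s] is paid
    only once, because the induction starts from the whole ring. *)
Lemma covers_mod_pow (K : fieldType) (r : nat) (J : {mpoly K[r]} -> Prop) l c s D n :
  homogeneous_ideal J -> l \is c.-homog -> (c <= s)%N ->
  generated_by_forms D J -> covers_mod J l c s ->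
  covers_mod (ideal_pow J n) l c (s + n * D).
Proof.
move=> hJ hl cs gJ cJ; elim: n => [|n IH] t u st hu.
  by exists u, 0; rewrite mulr0 addr0; split=> //; apply: dhomog0.
have [_ ND NM] := ideal_pow_ideal n.+1 (proj1 hJ).
have [y [h [Jy hh uE]]] : exists y h, [/\ J y, h \is (t - c).-homog & u = y + l * h].
  by apply: cJ hu; apply: leq_trans st; apply: leq_addr.
have ct : (c <= t)%N by apply: leq_trans cs _; apply: leq_trans st; apply: leq_addr.
have [y' [h' [Jy' hh' yE]]] : exists y' h', [/\ ideal_pow J n.+1 y',
    h' \is (t - c).-homog & pihomog mdeg t y = y' + l * h'].
  move: (gJ y Jy); move: y {Jy uE}; apply: sums_of_products_ind.
  - exists 0, 0; rewrite raddf0 mulr0 addr0; split=> //; last exact: dhomog0.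
    exact: sums_of_products0.
  - move=> a b [ya [ha [Ja hha aE]]] [yb [hb [Jb hhb bE]]].
    exists (ya + yb), (ha + hb); split; [exact: ND|exact: rpredD|].
    by rewrite raddfD /= aE bE mulrDr addrACA.
  move=> b x _ [Jx [d dD hx]].
  have dt : (d <= t)%N.
    by apply: leq_trans dD _; apply: leq_trans st; rewrite mulSn addnCA leq_addr.
  have [|z [k [Jz hk zE]]] := IH (t - d)%N (pihomog mdeg (t - d) b) _ (pihomogP _ _ _).
    rewrite leq_subRL // addnC -addnA; apply: leq_trans st.
    by rewrite leq_add2l mulSn addnC leq_add2r.
  exists (x * z), (x * k); split; first exact: ideal_powS.
    have -> : (t - c = d + (t - d - c))%N.
      rewrite addnBA ?subnKC // leq_subRL //; apply: leq_trans st.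
      by rewrite mulSn addnCA leq_add // (leq_trans cs) // leq_addr.
    exact: dhomogM.
  by rewrite mulrC (pihomogM _ _ hx) dt zE mulrDr mulrCA.
exists y', (h' + h); split; [by []|exact: rpredD|].
rewrite -(pihomog_dE hu) uE raddfD /= yE -addrA; congr (_ + _).
rewrite mulrDr; congr (_ + _); apply: pihomog_dE.
by rewrite -(subnKC ct); apply: dhomogM.
Qed.

(** Above degree [T], a form [u] of [M] is [g + l * h] with [g] already generated. Then [l * h] is
    in [M], so [h] is too unless [l = 0], and [h] has smaller degree because [c] is positive. *)
Lemma generated_below (K : fieldType) (r : nat) (Q M : {mpoly K[r]} -> Prop) l c T :
  homogeneous_ideal M -> (forall x, Q x -> M x) -> l \is c.-homog ->
  (0 < c)%N -> (c <= T)%N -> (l = 0 \/ forall x, M (l * x) -> M x) ->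
  covers_mod Q l c T ->
  generates (fun x => M x /\ (msize x <= T.+1)%N) M.
Proof.
move=> [idM hM] QM hl c0 cT lM cov x; split; last first.
  by apply: generated_sub => // s [].
have [M0 MD MM] := idM.
pose G := sums_of_products (fun=> True) (fun x => M x /\ (msize x <= T.+1)%N).
have idG : is_ideal G by apply: sums_of_products_ideal.
have GM y : G y -> M y by apply: generated_sub => // s [].
have [G0 GD GMul] := idG.
have hom t : forall u, u \is t.-homog -> M u -> G u.
  have [k] := ubnP t; elim: k t => // k IH t tk u hu Mu.
  have [tT|Tt] := leqP t T.
    rewrite -[u]mul1r; apply: sums_of_productsM => //; split=> //.
    exact: leq_trans (msize_dhomog hu) _.
  case: t Tt tk hu => // t Tt tk hu.
  have ct : (c <= t)%N by apply: leq_trans cT _.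
  (* Covering [u] itself would leave a remainder of the same degree [t.+1]. Covering the
     coefficients of the variables, in degree [t], leaves remainders within reach of the induction
     hypothesis. *)
  have [g [h [Gg hh uE]]] : exists g h, [/\ G g, h \is (t.+1 - c).-homog & u = g + l * h].
    move: u hu {Mu}; apply: dhomogS_ind.
    - by exists 0, 0; rewrite mulr0 addr0; split=> //; apply: dhomog0.
    - move=> a b [ya [ha [Ja hha aE]]] [yb [hb [Jb hhb bE]]].
      exists (ya + yb), (ha + hb); split; [exact: GD|exact: rpredD|].
      by rewrite aE bE mulrDr addrACA.
    move=> i v hv; have [y [h [Qy hh vE]]] := cov t v Tt hv.
    exists ('X_i * y), ('X_i * h); split.
    - apply: GMul; apply: (IH t); [by []| |exact: QM].
      have -> : y = v - l * h by rewrite vE addrK.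
      by rewrite rpredB // -(subnKC ct) dhomogM.
    - by rewrite subSn // -add1n; apply: dhomogM => //; rewrite dhomogX; apply/eqP; exact: mdeg1.
    by rewrite vE mulrDr mulrCA.
  case: lM => [l0|lM]; first by rewrite uE l0 mul0r addr0.
  rewrite uE; apply: GD => //; apply: GMul; apply: (IH (t.+1 - c)%N) => //.
    by move: tk; rewrite ltnS; apply: leq_trans; rewrite ltn_subrL c0.
  apply: lM; have -> : l * h = u + (-1) * g by rewrite mulN1r uE addrAC subrr add0r.
  by apply: MD => //; apply: MM; apply: GM.
move=> Mx; rewrite [x]pihomog_sum; apply: (big_ind G) => // i _.
by apply: hom (hM _ _ Mx); apply: pihomogP.
Qed.

(** * Two coprime ternary forms *)

Lemma dhomog_mul_cast (K : fieldType) (r d s t : nat) (g : {mpoly K[r]})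
    (hg : g \is d.-homog) (e : (d + s = t)%N) (p : dhomog r K s) :
  g * val p \is t.-homog.
Proof. by rewrite -e dhomogM // dhomog_is_dhomog. Qed.

(** The target degree is tied to [d + s] only by the equation [e], so that multiplications by forms
    of different degrees share a codomain. *)
Definition mul_dhomog (K : fieldType) (r d s t : nat) (g : {mpoly K[r]})
    (hg : g \is d.-homog) (e : (d + s = t)%N) (p : dhomog r K s) : dhomog r K t :=
  DHomog (dhomog_mul_cast hg e p).

Lemma mul_dhomog_is_linear (K : fieldType) (r d s t : nat) (g : {mpoly K[r]})
    (hg : g \is d.-homog) (e : (d + s = t)%N) : linear (mul_dhomog hg e).
Proof.
move=> c p q; apply/val_inj => /=.
by rewrite mulrDr -mul_mpolyC mulrCA mul_mpolyC.
Qed.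

HB.instance Definition _ (K : fieldType) (r d s t : nat) (g : {mpoly K[r]})
    (hg : g \is d.-homog) (e : (d + s = t)%N) :=
  GRing.isLinear.Build K (dhomog r K s) (dhomog r K t) _ (mul_dhomog hg e)
    (mul_dhomog_is_linear hg e).

Lemma dim_limg_mul_dhomog (K : fieldType) (r d s t : nat) (g : {mpoly K[r.+1]})
    (hg : g \is d.-homog) (e : (d + s = t)%N) : g != 0 ->
  \dim (limg (linfun (mul_dhomog hg e))) = 'C(s + r, s).
Proof.
move=> g0; rewrite limg_dim_eq; first by rewrite dimvf.
rewrite (_ : lker _ = 0%VS) ?capv0 //; apply/eqP/lker0P => p q.
rewrite !lfunE => /(congr1 val) /= E; apply/val_inj.
exact: (mulfI g0).
Qed.

(* [a * b] is the value of the Hilbert function of a complete intersection of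
   ternary forms of degrees [a] and [b] in degree [a + b + k]. *)
Lemma hilbert_bezout (a b k : nat) :
  ('C(a + b + k + 2, a + b + k) + 'C(k + 2, k) =
   a * b + ('C(b + k + 2, b + k) + 'C(a + k + 2, a + k)))%N.
Proof.
have E n : 'C(n + 2, n) = 'C(n.+2, 2).
  by rewrite -[in LHS](@bin_sub (n + 2) n) ?leq_addr // addKn addn2.
rewrite !E; elim: a => [|a IH]; first by rewrite mul0n !add0n addnC.
rewrite !addSn [in LHS]binS bin1 ['C((a + k).+3, 2)]binS bin1 mulSn; lia.
Qed.

(** Coprimality puts the common multiples of [g] and [h] among the multiples of [g * h]. Counting
    dimensions with [hilbert_bezout], the forms [g * p + h * q] of degree [d + e + k] have
    codimension at most [d * e]. *)
Lemma coprime_forms_dependent (K : fieldType) (g h : {mpoly K[3]}) d e k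
    (u : nat -> {mpoly K[3]}) :
  g \is d.-homog -> h \is e.-homog -> g != 0 -> h != 0 ->
  (forall v w, g * v = h * w -> divides g w) ->
  (forall i, u i \is (d + e + k).-homog) ->
  exists c : nat -> K, (exists2 i, (i <= d * e)%N & c i != 0) /\
    exists p q, \sum_(i < (d * e).+1) c i *: u i = g * p + h * q.
Proof.
move=> hg hh g0 h0 cop hu.
have e1 : (d + (e + k) = d + e + k)%N by rewrite addnA.
have e2 : (e + (d + k) = d + e + k)%N by rewrite addnA [(e + d)%N]addnC.
have hgh : g * h \is (d + e).-homog by apply: dhomogM.
pose G := limg (linfun (mul_dhomog hg e1)).
pose H := limg (linfun (mul_dhomog hh e2)).
have GH : (G :&: H <= limg (linfun (mul_dhomog hgh (erefl (d + e + k)%N))))%VS.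
  apply/subvP => x /memv_capP [/memv_imgP [p _ xp] /memv_imgP [q _ xq]].
  have E : g * val p = h * val q.
    by move: xp; rewrite xq !lfunE => /(congr1 val) /= ->.
  have [w qw] := cop _ _ E.
  have hq : val q = pihomog mdeg (d + k) (g * w).
    by rewrite mulrC -qw pihomog_dE // dhomog_is_dhomog.
  rewrite (pihomogMX _ _ hg) in hq.
  apply/memv_imgP; exists (DHomog (pihomogP mdeg k w)); rewrite ?memvf //.
  by apply/val_inj; rewrite xq !lfunE /= hq mulrCA mulrA.
have dimW : (\dim (G + H) + d * e >= 'C(d + e + k + 2, d + e + k))%N.
  have := dimv_leqif_sup GH; rewrite dim_limg_mul_dhomog ?mulf_neq0 // => -[D _].
  have := dimv_add_leqif G H => -[_ _].
  have := dimv_sum_cap G H; rewrite !dim_limg_mul_dhomog //.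
  have := hilbert_bezout d e k; lia.
pose X := [tuple DHomog (hu i) | i < (d * e).+1].
have XE (i : 'I_(d * e).+1) : X`_i = DHomog (hu i) by rewrite -tnth_nth tnth_mktuple.
have fin (c : 'I_(d * e).+1 -> K) :
    (exists i, c i != 0) -> \sum_i c i *: X`_i \in (G + H)%VS ->
  exists c : nat -> K, (exists2 i, (i <= d * e)%N & c i != 0) /\
    exists p q, \sum_(i < (d * e).+1) c i *: u i = g * p + h * q.
  case=> i ci /memv_addP [_ /memv_imgP [p _ ->] [_ /memv_imgP [q _ ->]]] E.
  exists (fun n => c (inord n)); split.
    by exists i; rewrite ?inord_val // -ltnS.
  exists (val p), (val q); move/(congr1 val): E; rewrite !lfunE raddf_sum /= => <-.
  by apply: eq_bigr => j _; rewrite inord_val XE.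
(* If [X] is not free, a linear relation does, as [0] is in [G + H]. If it is free, its span is too
   large to meet [G + H] trivially. *)
case: (boolP (free X)) => [fX|]; last first.
  move/freeP => nf; apply: NNPP => N; apply: nf => c c0 i; apply/eqP/negPn/negP => ci.
  by apply: N; apply: (fin c); [exists i|rewrite c0 mem0v].
have dX : \dim <<X>> = (d * e).+1 by move: fX; rewrite /free size_tuple => /eqP.
have cap : (0 < \dim (<<X>> :&: (G + H)))%N.
  have := dimv_sum_cap <<X>> (G + H); have := dimvS (subvf (<<X>> + (G + H))%VS).
  by rewrite dimvf dX; move: dimW; rewrite /dim /=; lia.
have v0 : vpick (<<X>> :&: (G + H)) != 0 by rewrite vpick0 -dimv_eq0 -lt0n.
have /memv_capP [vX vW] := memv_pick (<<X>> :&: (G + H))%VS.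
apply: (fin (fun i => coord X i (vpick (<<X>> :&: (G + H))))).
  apply: NNPP => N; case/negP: v0; rewrite (coord_span vX) big1 // => i _.
  have [->|ci] := eqVneq (coord X i (vpick (<<X>> :&: (G + H)))) 0; first by rewrite scale0r.
  by case: N; exists i.
by rewrite -coord_span.
Qed.

(** * Forms that are regular modulo a radical ideal *)

Lemma pihomog_mul_extremal (R : idomainType) (r : nat) (a b : {mpoly R[r]}) d e :
  pihomog mdeg d a != 0 ->
  (forall i j, (i + j = d + e)%N -> pihomog mdeg i a != 0 ->
     pihomog mdeg j b != 0 -> i = d) ->
  pihomog mdeg (d + e) (a * b) = pihomog mdeg d a * pihomog mdeg e b.
Proof.
move=> ad ext; rewrite {1}[a]pihomog_sum mulr_suml raddf_sum /=.
have lt : (d < msize a)%N.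
  by rewrite ltnNge; apply: contraNN ad => /pihomog_geq_msize ->.
rewrite (bigD1 (Ordinal lt)) //= (pihomogMX _ _ (pihomogP _ _ _)).
rewrite big1 ?addr0 // => i; rewrite -val_eqE /= => ne.
rewrite (pihomogM _ _ (pihomogP _ _ _)); case: ifP => // le.
apply/eqP; rewrite mulf_eq0; apply/negPn/negP; rewrite negb_or => /andP[ai bi].
by move: ne; rewrite (ext i _ _ ai bi) ?eqxx // subnKC.
Qed.

Lemma dhomog_lowest (R : idomainType) (r : nat) (a : {mpoly R[r]}) :
  a != 0 -> exists2 d, pihomog mdeg d a != 0 &
    forall i, pihomog mdeg i a != 0 -> (d <= i)%N.
Proof.
move=> a0; have ex : exists d, pihomog mdeg d a != 0.
  apply: NNPP => N; case/negP: a0; rewrite [a]pihomog_sum big1 // => i _.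
  by apply/eqP/negPn/negP => ai; apply: N; exists i.
by case: (ex_minnP ex) => d ad H; exists d.
Qed.

Lemma dhomog_highest (R : idomainType) (r : nat) (a : {mpoly R[r]}) :
  a != 0 -> exists2 d, pihomog mdeg d a != 0 &
    forall i, pihomog mdeg i a != 0 -> (i <= d)%N.
Proof.
move=> a0; have [d0 ad0 _] := dhomog_lowest a0.
have ub i : pihomog mdeg i a != 0 -> (i <= msize a)%N.
  by rewrite leqNgt; apply: contraNN => /ltnW /pihomog_geq_msize ->.
by case: (ex_maxnP (ex_intro _ d0 ad0) ub) => d ad H; exists d.
Qed.

(* The products of the lowest components and of the highest components survive
   in [a * b], so they have the same degree. *)
Lemma dhomog_factor (R : idomainType) (r : nat) (a b : {mpoly R[r]}) t :
  a * b != 0 -> a * b \is t.-homog -> exists d, a \is d.-homog.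
Proof.
rewrite mulf_eq0 negb_or => /andP[a0 b0] hab.
have [d ad dmin] := dhomog_lowest a0; have [e be emin] := dhomog_lowest b0.
have [d' ad' dmax] := dhomog_highest a0; have [e' be' emax] := dhomog_highest b0.
have E1 := pihomog_mul_extremal (e := e) ad _; have E2 := pihomog_mul_extremal (e := e') ad' _.
have F1 : (d + e = t)%N.
  apply/eqP; apply: contraTT be => ne; rewrite -(inj_eq (mulfI ad)) mulr0 -E1.
    by rewrite (pihomog_ne0 _ hab) ?eqxx // eq_sym.
  by move=> i j ij /dmin ? /emin ?; lia.
have F2 : (d' + e' = t)%N.
  apply/eqP; apply: contraTT be' => ne; rewrite -(inj_eq (mulfI ad')) mulr0 -E2.
    by rewrite (pihomog_ne0 _ hab) ?eqxx // eq_sym.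
  by move=> i j ij /dmax ? /emax ?; lia.
have dd : d' = d by have := dmin _ ad'; have := emin _ be'; lia.
exists d; rewrite [a]pihomog_sum rpred_sum // => i _.
have [->|ai] := eqVneq (pihomog mdeg i a) 0; first exact: dhomog0.
have <- : nat_of_ord i = d by have := dmin _ ai; have := dmax _ ai; lia.
exact: pihomogP.
Qed.

Lemma dhomog0_unit (K : fieldType) (r : nat) (a : {mpoly K[r]}) :
  a != 0 -> a \is 0.-homog -> a \is a GRing.unit.
Proof.
move=> a0 ha; have sa : (msize a <= 1)%N := msize_dhomog ha.
have aE : a = (a@_0%MM)%:MP by apply: msize1_polyC.
rewrite aE; apply: (rmorph_unit (@mpolyC r K)).
by rewrite unitfE; apply: contraNneq a0 => c0; rewrite aE c0.
Qed.

Lemma prime_elt_dhomog_gt0 (K : fieldType) (r : nat) (p : {mpoly K[r]}) d :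
  prime_elt p -> p \is d.-homog -> (0 < d)%N.
Proof.
case=> p0 pU _; case: d => // hp; case/negP: pU; exact: dhomog0_unit.
Qed.

(** Prime avoidance within forms. If [p] divides [h], a power of [h] is added to a power of a form
    of [J] that avoids [p] but is divisible by all earlier primes; the exponents equalize the
    degrees. *)
Lemma form_avoiding_primes (K : fieldType) (r : nat) (J : {mpoly K[r]} -> Prop)
    (ps : seq {mpoly K[r]}) :
  is_ideal J -> ~ J 1 ->
  (forall p, p \in ps -> [/\ prime_elt p, exists d, p \is d.-homog &
     exists j d, [/\ J j, j \is d.-homog & ~ divides p j]]) ->
  (exists h d, [/\ J h, h \is d.-homog & h != 0]) ->
  exists h d, [/\ J h, h \is d.-homog, h != 0 &
    forall p, p \in ps -> ~ divides p h].
Proof.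
move=> [J0 JD JM] J1 H ex; elim: ps H => [|p ps IH] H.
  by have [h [d [? ? ?]]] := ex; exists h, d.
have pos x d : J x -> x \is d.-homog -> x != 0 -> (0 < d)%N.
  move=> Jx hx x0; rewrite lt0n; apply/eqP => d0; rewrite d0 in hx.
  by apply: J1; rewrite -(mulVr (dhomog0_unit x0 hx)); apply: JM.
have [|h [d [Jh hh h0 hps]]] := IH; first by move=> q qs; apply: H; rewrite inE qs orbT.
have [pp [dp hp] [j [dj [Jj hj pj]]]] := H p (mem_head _ _).
case: (classic (divides p h)) => ph; last first.
  exists h, d; split=> // q; rewrite inE => /orP[/eqP -> //|]; exact: hps.
pose x := j * \prod_(q <- ps) q.
have px : ~ divides p x.
  (* If [p] divided an earlier prime [q], the two would be associates, and [q] would divide [h]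
     along with [p]. *)
  have [_ _ pP] := pp; case/pP => // /(prime_elt_divides_prod pp) [q qps [c qE]].
  have [|pq _ _] := H q; first by rewrite inE qps orbT.
  have [q0 _ qP] := pq; have [_ pU _] := pp.
  have /qP [[c' cE]|[c' pE]] : divides q (c * p) by rewrite -qE; apply: dividesxx.
    case/negP: pU; apply/unitrPr; exists c'; apply: (mulfI q0); rewrite mulr1.
    transitivity (c' * q * p); last by rewrite -cE -qE.
    by rewrite mulrA mulrC mulrA.
  apply: (hps q qps); case: ph => z ->; rewrite pE mulrA.
  by exists (z * c').
have x0 : x != 0 by apply/eqP => x0; apply: px; rewrite x0; exists 0; rewrite mul0r.
have Jx : J x by rewrite /x mulrC; apply: JM.
have [e hx] : exists e, x \is e.-homog.
  have [e he] : exists e, \prod_(q <- ps) q \is e.-homog.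
    have {}H q : q \in ps -> exists d, q \is d.-homog.
      by move=> qs; have [|_ ? _] := H q; rewrite ?inE ?qs ?orbT.
    elim: ps H {IH hps x px x0 Jx} => [|q ps IH] H; first by exists 0%N; rewrite big_nil dhomog1.
    have [|e he] := IH; first by move=> q' qs; apply: H; rewrite inE qs orbT.
    have [e' he'] := H q (mem_head _ _).
    by exists (e' + e)%N; rewrite big_cons dhomogM.
  by exists (dj + e)%N; apply: dhomogM.
have d0 := pos _ _ Jh hh h0; have e0 := pos _ _ Jx hx x0.
have expS y k : (0 < k)%N -> J y -> J (y ^+ k).
  by case: k => // k _ Jy; rewrite exprSr; apply: JM.
have divS q y k : (0 < k)%N -> divides q y -> divides q (y ^+ k).
  by case: k => // k _ Dy; rewrite exprSr; apply: divides_mull.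
have py : ~ divides p (h ^+ e + x ^+ d).
  move=> D; apply/px/(prime_elt_divides_exp (k := d) pp).
  have -> : x ^+ d = (h ^+ e + x ^+ d) - h ^+ e by rewrite addrAC subrr add0r.
  by apply: dividesB => //; apply: divS.
exists (h ^+ e + x ^+ d), (d * e)%N; split.
- by apply: JD; apply: expS.
- by rewrite rpredD // ?dhomogMn // mulnC dhomogMn.
- by apply/eqP => E; apply: py; rewrite E; exists 0; rewrite mul0r.
move=> q; rewrite inE => /orP[/eqP -> //|qps] D.
have [|pq _ _] := H q; first by rewrite inE qps orbT.
apply: (hps q qps); apply: (prime_elt_divides_exp (k := e) pq).
have -> : h ^+ e = (h ^+ e + x ^+ d) - x ^+ d by rewrite addrK.
apply: dividesB => //; apply: divS => //.
by rewrite /x (perm_big _ (perm_to_rem qps)) /= big_cons mulrCA; exists (j * \prod_(i <- rem q ps) i); rewrite mulrC.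
Qed.

(* That is, [dim (A/J)_t <= N] for all [t >= t0]. *)
Definition forms_bounded_mod (K : fieldType) (r : nat) (J : {mpoly K[r]} -> Prop)
    (N t0 : nat) : Prop :=
  forall t (u : nat -> {mpoly K[r]}), (t0 <= t)%N ->
  (forall i, (i <= N)%N -> u i \is t.-homog) ->
  exists c : nat -> K, (exists2 i, (i <= N)%N & c i != 0) /\
    J (\sum_(i < N.+1) c i *: u i).

Lemma forms_bounded_mod_coprime (K : fieldType) (J : {mpoly K[3]} -> Prop)
    (g h : {mpoly K[3]}) d e :
  is_ideal J -> J g -> J h -> g \is d.-homog -> h \is e.-homog ->
  g != 0 -> h != 0 -> (forall v w, g * v = h * w -> divides g w) ->
  forms_bounded_mod J (d * e) (d + e).
Proof.
move=> [J0 JD JM] Jg Jh hg hh g0 h0 cop t u /subnKC <- hu.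
pose u' i := if (i <= d * e)%N then u i else 0.
have hu' i : u' i \is (d + e + (t - (d + e))).-homog.
  by rewrite /u'; case: ifP => [/hu //|_]; apply: dhomog0.
have [c [ex [p [q E]]]] := coprime_forms_dependent hg hh g0 h0 cop hu'.
exists c; split=> //; rewrite (eq_bigr (fun i : 'I_ _ => c i *: u' i)).
  by rewrite E; apply: JD; rewrite mulrC; apply: JM.
by move=> i _; rewrite /u' -ltnS ltn_ord.
Qed.

(** For a radical [J], these forms have nonempty and pairwise disjoint nonvanishing loci on the zero
    scheme of [J]. The common degree makes their sum a form. *)
Definition orthogonal_forms (K : fieldType) (r : nat) (J : {mpoly K[r]} -> Prop)
    (k : nat) : Prop :=
  exists c (g : nat -> {mpoly K[r]}), [/\ (0 < c)%N,
    forall i, (i < k)%N -> g i \is c.-homog /\ ~ J (g i) &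
    forall i j, (i < k)%N -> (j < k)%N -> i != j -> J (g i * g j)].

Lemma ideal_scale_inv (K : fieldType) (r : nat) (J : {mpoly K[r]} -> Prop) c x :
  is_ideal J -> c != 0 -> J (c *: x) -> J x.
Proof.
move=> [_ _ JM] c0 Jcx; rewrite -[x](scalerK c0) -mul_mpolyC; exact: JM.
Qed.

Lemma ideal_sum (R : comNzRingType) (J : R -> Prop) (I : Type) (s : seq I)
    (P : pred I) (F : I -> R) :
  is_ideal J -> (forall i, P i -> J (F i)) -> J (\sum_(i <- s | P i) F i).
Proof. by case=> J0 JD _; apply: big_ind. Qed.

Lemma ideal_addKl (R : comNzRingType) (J : R -> Prop) x y :
  is_ideal J -> J (x + y) -> J y -> J x.
Proof.
case=> _ JD JM Jxy Jy; rewrite -(addrK y x); apply: JD => //.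
by rewrite -mulN1r; apply: JM.
Qed.

(** The powers [g i ^+ t0.+1] share a degree that is at least [t0], so [N.+1] of them are dependent
    modulo [J]. Multiplying the relation by [g j] isolates a power of [g j], and [J] is radical. *)
Lemma orthogonal_forms_bounded (K : fieldType) (r : nat)
    (J : {mpoly K[r]} -> Prop) N t0 :
  is_ideal J -> is_radical J -> forms_bounded_mod J N t0 ->
  ~ orthogonal_forms J N.+1.
Proof.
move=> idJ radJ bJ [c [g [c0 hg og]]]; have [_ _ JM] := idJ.
have [||k [[j jN kj] Js]] := bJ (c * t0.+1)%N (fun i => g i ^+ t0.+1).
- by rewrite (leq_trans (leqnSn _)) // leq_pmull.
- by move=> i iN; apply: dhomogMn; case: (hg i).
have [_ []] := hg j jN; apply: (radJ _ t0.+2); apply: (ideal_scale_inv idJ kj).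
move: (JM (g j) _ Js); rewrite mulr_sumr (bigD1 (Ordinal (jN : (j < N.+1)%N))) //=.
rewrite -mul_mpolyC mulrCA -exprS mul_mpolyC => /(ideal_addKl idJ); apply.
apply: ideal_sum => // i; rewrite -val_eqE /= => ij.
rewrite -mul_mpolyC mulrCA exprS mulrA mulrA [_ * _ * g i ^+ _]mulrC; apply: (JM).
by rewrite -mulrA; apply: JM; apply: og => //; rewrite eq_sym.
Qed.

(* The sum of a maximal family of pairwise orthogonal forms modulo [J] is a
   nonzerodivisor modulo [J]: a form killed by it would enlarge the family. *)
Lemma exists_regular_form (K : fieldType) (r : nat) (J : {mpoly K[r]} -> Prop) N t0 :
  homogeneous_ideal J -> is_radical J -> forms_bounded_mod J N t0 ->
  (exists c g, [/\ (0 < c)%N, g \is c.-homog & ~ J g]) ->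
  exists l c, [/\ (0 < c)%N, l \is c.-homog & forall x, J (x * l) -> J x].
Proof.
move=> [idJ hJ] radJ bJ [c1 [g1 [c10 hg1 Jg1]]]; have [J0 JD JM] := idJ.
have [k [k0 ok nok]] : exists k, [/\ (0 < k)%N, orthogonal_forms J k & ~ orthogonal_forms J k.+1].
  apply: NNPP => N0; apply: (orthogonal_forms_bounded idJ radJ bJ).
  elim: N.+1 (ltn0Sn N) => // m IH _; case: m IH => [|m] IH.
    exists c1, (fun=> g1); split=> // i j; rewrite !ltnS !leqn0 => /eqP -> /eqP ->.
    by [].
  by apply: NNPP => Nm; apply: N0; exists m.+1; split=> //; apply: IH.
have [c [g [c0 hg og]]] := ok.
exists (\sum_(i < k) g i), c; split=> //.
  by rewrite rpred_sum // => i _; case: (hg i).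
have hl : \sum_(i < k) g i \is c.-homog by rewrite rpred_sum // => i _; case: (hg i).
have main h d : h \is d.-homog -> J (h * \sum_(i < k) g i) -> J h.
  move=> hh Jhl; apply: NNPP => Jh.
  (* Multiplying by [g i] removes the other summands and leaves [h * g i ^+ 2], so the square of
     [h * g i] is in [J]. *)
  have Jhg i : (i < k)%N -> J (h * g i).
    move=> ik; apply: (radJ _ 2%N); rewrite exprMn expr2 -mulrA; apply: (JM).
    move: (JM (g i) _ Jhl); rewrite mulrCA mulr_sumr (bigD1 (Ordinal ik)) //= mulrDr -expr2.
    move/(ideal_addKl idJ); apply; apply: JM; apply: ideal_sum => // j.
    by rewrite -val_eqE /= => ji; apply: og => //; rewrite eq_sym.
  have [d0|d0] := posnP d.
    rewrite d0 in hh; have h0 : h != 0 by apply/eqP => h0; apply: Jh; rewrite h0.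
    have [_ []] := hg 0%N k0; rewrite -(mulKr (dhomog0_unit h0 hh) (g 0%N)).
    by apply: JM; apply: Jhg.
  (* The exponents bring all forms to degree [c * d]; as [J] is radical, the powers stay outside
     it. *)
  apply: nok; exists (c * d)%N, (fun i => if (i < k)%N then g i ^+ d else h ^+ c).
  have nJ x m : ~ J x -> ~ J (x ^+ m) by move=> Jx Jxm; apply: Jx; apply: radJ Jxm.
  have expJ x y m n : (0 < m)%N -> (0 < n)%N -> J (x * y) -> J (x ^+ m * y ^+ n).
    case: m n => // m [] // n _ _ Jxy; rewrite !exprSr mulrACA; exact: JM.
  split; first by rewrite muln_gt0 c0.
    move=> i ik; case: ifP => ik'; first by have [? ?] := hg i ik'; split; [apply: dhomogMn|apply: nJ].
    by split; [rewrite mulnC; apply: dhomogMn|apply: nJ].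
  move=> i j ik jk ij; case: ifP => ik'; case: ifP => jk'.
  - by apply: expJ => //; apply: og.
  - by rewrite mulrC; apply: expJ => //; apply: Jhg.
  - by apply: expJ => //; apply: Jhg.
  by move: ij; lia.
move=> x Jxl; rewrite [x]pihomog_sum; apply: ideal_sum => // i _.
apply: (main _ i); first exact: pihomogP.
by rewrite mulrC -(pihomogMX _ _ hl) mulrC; apply: hJ.
Qed.

Lemma finite_choice (T : Type) (x0 : T) (P : nat -> T -> Prop) n :
  (forall i, (i < n)%N -> exists x, P i x) ->
  exists u, forall i, (i < n)%N -> P i (u i).
Proof.
elim: n => [|n IH] H; first by exists (fun=> x0).
have [i /ltnW|u Pu] := IH; first exact: H.
have [x Px] := H n (ltnSn n).
exists (fun i => if i == n then x else u i) => i.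
by rewrite ltnS leq_eqVlt; case: eqP => [-> //|_] /= /Pu.
Qed.

(** One covered degree [t >= c] suffices, since multiplying by variables passes the property
    upwards. If all multiples of [c] failed, uncovered forms of degrees [c], ..., [c * N.+1],
    brought to one degree by powers of [l], would satisfy a relation modulo [J]. Cancelling the
    smallest power of [l] in it would cover one of them. *)
Lemma covers_mod_regular (K : fieldType) (r : nat) (J : {mpoly K[r]} -> Prop) N t0 l c :
  homogeneous_ideal J -> forms_bounded_mod J N t0 ->
  (0 < c)%N -> l \is c.-homog -> (forall x, J (x * l) -> J x) ->
  exists2 s, (c <= s)%N & covers_mod J l c s.
Proof.
move=> [idJ hJ] bJ c0 hl lJ; have [J0 JD JM] := idJ.
pose good t := forall u, u \is t.-homog ->
  exists y h, [/\ J y, h \is (t - c).-homog & u = y + l * h].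
have goodS t : (c <= t)%N -> good t -> good t.+1.
  move=> ct gt; apply: dhomogS_ind.
  - by exists 0, 0; rewrite mulr0 addr0; split=> //; apply: dhomog0.
  - move=> a b [ya [ha [Ja hha aE]]] [yb [hb [Jb hhb bE]]].
    exists (ya + yb), (ha + hb); split; [exact: JD|exact: rpredD|].
    by rewrite aE bE mulrDr addrACA.
  move=> i v hv; have [y [h [Jy hh vE]]] := gt v hv.
  exists ('X_i * y), ('X_i * h); split; first exact: JM.
    by rewrite subSn // -add1n; apply: dhomogM => //; rewrite dhomogX; apply/eqP; exact: mdeg1.
  by rewrite vE mulrDr mulrCA.
have [i gi] : exists i, good (c * i.+1)%N.
  apply: NNPP => bad.
  have ch i : exists u, u \is (c * i.+1).-homog /\
      ~ exists y h, [/\ J y, h \is (c * i.+1 - c).-homog & u = y + l * h].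
    apply: NNPP => N0; apply: bad; exists i => u hu; apply: NNPP => N1.
    by apply: N0; exists u.
  have [u hu] := finite_choice 0 (n := N.+1) (fun i _ => ch i).
  (* In the exponent, [N] avoids truncation for [i <= N], and [t0] carries the common degree beyond
     the threshold of [bJ]. *)
  have [||k [[m mN km] Js]] := bJ (c * (N + t0).+1)%N (fun i => l ^+ (N + t0 - i) * u i).
  - by have := leq_pmull (N + t0).+1 c0; lia.
  - move=> i iN; have -> : (c * (N + t0).+1 = c * (N + t0 - i) + c * i.+1)%N.
      by rewrite -mulnDr addnS subnK // (leq_trans iN) // leq_addr.
    by apply: dhomogM; [apply: dhomogMn|case: (hu i)].
  have cancel_pow n x : J (l ^+ n * x) -> J x.
    elim: n => [|n IH]; first by rewrite mul1r.
    by rewrite exprS -mulrA => Jx; apply/IH/lJ; rewrite mulrC.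
  suff H n : (n <= N.+1)%N -> J (\sum_(i < n) k i *: (l ^+ (N + t0 - i) * u i)) ->
      forall i, (i < n)%N -> k i = 0.
    by move: km; rewrite (H _ (leqnn _) Js m) ?eqxx.
  elim: n => // n IH nN; rewrite big_ord_recr /=.
  have [kn|kn] := eqVneq (k n) 0.
    rewrite kn scale0r addr0 => /(IH (ltnW nN)) {}IH i.
    by rewrite ltnS leq_eqVlt => /orP[/eqP ->|/IH].
  (* Here [n] is the last index with a nonzero coefficient. Cancelling [l ^+ (N + t0 - n)] leaves
     [l * h + k n *: u n] in [J], contrary to the choice of [u n]. *)
  pose h := \sum_(i < n) k i *: (l ^+ (n - i.+1) * u i).
  have -> : \sum_(i < n) k i *: (l ^+ (N + t0 - i) * u i) = l ^+ (N + t0 - n) * (l * h).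
    rewrite /h !mulr_sumr; apply: eq_bigr => i _.
    rewrite -!mul_mpolyC ![_ * (_%:MP * _)]mulrCA; congr (_ * _).
    by rewrite !mulrA -exprSr -exprD; congr (l ^+ _ * _); have := ltn_ord i; lia.
  rewrite -[k n *: _]mul_mpolyC [_%:MP * _]mulrCA -mulrDr mul_mpolyC => /cancel_pow Jy.
  have [_ []] := hu n nN; exists ((k n)^-1 *: (l * h + k n *: u n)), (- ((k n)^-1 *: h)).
  split; first by rewrite -mul_mpolyC; apply: JM.
    rewrite rpredN rpredZ // rpred_sum // => i _; rewrite rpredZ //.
    have -> : (c * n.+1 - c = c * (n - i.+1) + c * i.+1)%N.
      by rewrite -mulnDr subnK // mulnS addKn.
    by apply: dhomogM; [apply: dhomogMn|case: (hu i) => //; have := ltn_ord i; lia].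
  by rewrite scalerDr scalerK // mulrN -mul_mpolyC -[(k n)^-1 *: h]mul_mpolyC mulrCA addrAC subrr add0r.
exists (c * i.+1)%N; first by rewrite leq_pmulr.
move=> t u /subnKC <-; move: u; elim: (t - _)%N => [|n IH]; first by rewrite addn0.
by rewrite addnS; apply: goodS => //; apply: leq_trans (leq_addr _ _); rewrite leq_pmulr.
Qed.

(** * Degrees of generators of symbolic powers *)

Lemma generated_by_forms_le (K : fieldType) (r D : nat) (I : {mpoly K[r]} -> Prop) :
  homogeneous_ideal I -> generated_in_degrees_le D I -> generated_by_forms D I.
Proof.
move=> [idI hI] [S [SD SI]] x /SI.
have [G0 GD GM] := @sums_of_products_ideal _ (fun=> True)
  (fun s => I s /\ exists2 d, (d <= D)%N & s \is d.-homog) (fun _ _ _ => Logic.I).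
move: x; apply: sums_of_products_ind => // b s _ Ss; apply: GM.
have Is : I s by apply/SI; rewrite -[s]mul1r; apply: sums_of_productsM.
rewrite [s]pihomog_sum; apply: big_ind => // i _.
rewrite -[pihomog _ _ _]mul1r; apply: sums_of_productsM => //.
split; first exact: hI.
exists (nat_of_ord i); last exact: pihomogP.
by rewrite -ltnS; apply: leq_trans (SD _ Ss).
Qed.

(** Prime avoidance and the maximality of the common factor concern prime forms only, so prime
    factors of forms must be shown homogeneous. *)
Lemma dhomog_prime_factor (R : idomainType) (r d : nat) (f u p : {mpoly R[r]}) ps :
  factorization f u ps -> f != 0 -> f \is d.-homog -> p \in ps ->
  exists e, p \is e.-homog.
Proof.
case=> _ _ fE f0 hf pin.
have E : f = p * (u * \prod_(q <- rem p ps) q).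
  by rewrite fE (perm_big _ (perm_to_rem pin)) /= big_cons mulrCA.
rewrite E in f0 hf; exact: dhomog_factor f0 hf.
Qed.

(* The value [l = 0] stands for the case where [J] contains all forms of positive
   degree, in which no form of positive degree is regular modulo [J]. *)
Lemma exists_covering_form (K : fieldType) (J : {mpoly K[3]} -> Prop) :
  homogeneous_ideal J -> is_radical J -> (exists2 x, J x & x != 0) ->
  (forall p d, prime_elt p -> p \is d.-homog -> exists2 j, J j & ~ divides p j) ->
  exists l c s, [/\ (0 < c)%N, (c <= s)%N, l \is c.-homog, covers_mod J l c s &
    l = 0 \/ forall x, J (x * l) -> J x].
Proof.
move=> homJ radJ [x Jx x0] Jp; have [idJ hJ] := homJ.
have [ex|all] := classic (exists c g, [/\ (0 < c)%N, g \is c.-homog & ~ J g]); last first.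
  exists 0, 1%N, 1%N; split=> //; [exact: dhomog0| |by left].
  move=> t u t0 hu; exists u, 0; rewrite mulr0 addr0; split=> //; last exact: dhomog0.
  by apply: NNPP => Ju; apply: all; exists t, u.
have J1 : ~ J 1.
  by case: ex => c [g [_ _ Jg]] J1; apply: Jg; rewrite -[g]mulr1; case: idJ => _ _; apply.
have Jp' p d : prime_elt p -> p \is d.-homog ->
    exists j e, [/\ J j, j \is e.-homog & ~ divides p j].
  move=> pp hp; have [j Jj pj] := Jp p d pp hp; apply: NNPP => N; apply: pj.
  rewrite [j]pihomog_sum; apply: big_ind; first by exists 0; rewrite mul0r.
    exact: dividesD.
  move=> i _; apply: NNPP => pi; apply: N; exists (pihomog mdeg i j), i.
  by split=> //; [apply: hJ|apply: pihomogP].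
have [d xd _] := dhomog_lowest x0; pose g := pihomog mdeg d x.
have Jg : J g by apply: hJ.
have hg : g \is d.-homog by apply: pihomogP.
have [u [ps fact]] := @factorial_domain_mpoly K 3 g xd; have [uu pps gE] := fact.
have [||h [e [Jh hh h0 hps]]] := form_avoiding_primes (ps := ps) idJ J1.
- move=> p pin; have [d' hp] : exists d, p \is d.-homog.
    exact: dhomog_prime_factor fact xd hg pin.
  by split; [apply: pps|exists d'|apply: Jp' hp; apply: pps].
- by exists g, d.
(* As [h] avoids every prime factor of [g], it serves as the local multiplier at all of them. *)
have cop v w : g * v = h * w -> divides g w.
  move=> E; apply: (divides_local fact) => p pin; exists h; first exact: hps.
  by rewrite -E mulrC; apply/divides_mull/dividesxx.
have bJ := forms_bounded_mod_coprime idJ Jg Jh hg hh xd h0 cop.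
have [l [c [c0 hl lJ]]] := exists_regular_form homJ radJ bJ ex.
have [s cs cov] := covers_mod_regular homJ bJ c0 hl lJ.
by exists l, c, s; split=> //; right.
Qed.

Lemma max_homogeneous_factor (K : fieldType) (r : nat) (I : {mpoly K[r]} -> Prop) g :
  I g -> g != 0 ->
  exists f d, [/\ f \is d.-homog, f != 0, (forall x, I x -> divides f x) &
    forall f' d', f' \is d'.-homog -> f' != 0 -> (forall x, I x -> divides f' x) ->
    (d' <= d)%N].
Proof.
move=> Ig g0.
pose P d := exists f, [/\ f \is d.-homog, f != 0 & forall x, I x -> divides f x].
have P0 : P 0%N.
  by exists 1; rewrite dhomog1 oner_neq0; split=> // x _; exists x; rewrite mulr1.
have ub d : P d -> (d < msize g)%N.
  case=> f [hf f0 /(_ g Ig) [q gE]].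
  have q0 : q != 0 by apply: contraNneq g0 => q0; rewrite gE q0 mul0r.
  have sf : msize f = d.+1.
    apply/eqP; rewrite eqn_leq msize_dhomog //=.
    by have := dhomog_uniq f0 hf (dhomog_msize hf); rewrite (mpolySpred _ f0) => ->.
  by rewrite gE msizeM // sf (mpolySpred _ q0) addSn /= addnS ltnS leq_addl.
have [d [Pd Pmax]] : exists d, P d /\ forall d', P d' -> (d' <= d)%N.
  elim: (msize g) ub => [|n IH] ub; first by have := ub _ P0.
  have [Pn|Pn] := classic (P n); first by exists n; split=> // d' /ub; rewrite ltnS.
  apply: IH => d Pd; have := ub d Pd; rewrite ltnS leq_eqVlt => /orP[/eqP E|//].
  by rewrite E in Pd.
have [f [hf f0 If]] := Pd; exists f, d; split=> // f' d' hf' f'0 If'.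
by apply: Pmax; exists f'.
Qed.

Lemma generated_by_forms_quotient (K : fieldType) (r D d : nat)
    (I J : {mpoly K[r]} -> Prop) (f : {mpoly K[r]}) :
  f \is d.-homog -> f != 0 -> generated_by_forms D I ->
  (forall y, J y <-> I (f * y)) -> (forall y, I y -> divides f y) ->
  generated_by_forms (D - d) J.
Proof.
move=> hf f0 gI JI If x /JI /gI Ifx.
set S' := fun s => J s /\ _.
suff [y fxy Gy] : exists2 y, f * x = f * y & sums_of_products (fun=> True) S' y.
  by rewrite (mulfI f0 fxy).
move: (f * x) Ifx; apply: sums_of_products_ind.
- by exists 0; rewrite ?mulr0 //; apply: sums_of_products0.
- move=> _ _ [a -> Ga] [b -> Gb]; exists (a + b); rewrite ?mulrDr //.
  exact: sums_of_productsD.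
move=> b s _ [Is [e eD hs]]; have [z zE] := If s Is.
have sE : s = f * (if (d <= e)%N then pihomog mdeg (e - d) z else 0).
  rewrite -(pihomog_dE hs) zE mulrC (pihomogM _ _ hf).
  by case: ifP => // _; rewrite mulr0.
move: sE; set y := if _ then _ else _ => sE.
exists (b * y); first by rewrite sE mulrCA.
apply: sums_of_productsM => //; split; first by apply/JI; rewrite -sE.
rewrite /y; case: ifP => _; last by exists 0%N => //; apply: dhomog0.
by exists (e - d)%N; [apply: leq_sub2r|apply: pihomogP].
Qed.

(** Makes [D - d] a true difference, so that the degrees [n * d] of [f ^+ n] and [n * (D - d)] add
    up to [n * D]. *)
Lemma degree_common_factor_le (K : fieldType) (r D d : nat)
    (I : {mpoly K[r]} -> Prop) (f g : {mpoly K[r]}) :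
  f \is d.-homog -> (forall y, I y -> divides f y) -> generated_by_forms D I ->
  I g -> g != 0 -> (d <= D)%N.
Proof.
move=> hf If gI Ig g0; rewrite leqNgt; apply/negP => Dd; case/negP: g0; apply/eqP.
move: g {Ig} (gI g Ig); apply: sums_of_products_ind => //.
  by move=> a b -> ->; rewrite addr0.
move=> b s _ [Is [e eD hs]]; have [z zE] := If s Is.
suff -> : s = 0 by rewrite mulr0.
rewrite -(pihomog_dE hs) zE mulrC (pihomogM _ _ hf) leqNgt.
by rewrite (leq_ltn_trans eD Dd).
Qed.

(** The zero ideal is prime and is the annihilator of [1] modulo itself, so it is its own associated
    prime. For [n = 0] the symbolic power is the whole ring. *)
Lemma symbolic_power_zero (R : idomainType) (I : R -> Prop) n x :
  (forall y, I y <-> y = 0) -> (0 < n)%N -> symbolic_power I n x -> x = 0.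
Proof.
move=> I0 n0; have idI : is_ideal I.
  split; first exact/I0.
    by move=> a b /I0 -> /I0 ->; apply/I0; rewrite addr0.
  by move=> a b /I0 ->; apply/I0; rewrite mulr0.
move/(symbolic_powerP _ _ idI) => /(_ I) [|s Is].
  split; last by exists 1 => a; rewrite mulr1.
  split=> //; first by move/I0/eqP; rewrite oner_eq0.
  by move=> a b /I0 /eqP; rewrite mulf_eq0 => /orP[] /eqP ?; [left|right]; apply/I0.
have z m y : ideal_pow I m.+1 y -> y = 0.
  move: y; apply: sums_of_products_ind => //; first by move=> a b -> ->; rewrite addr0.
  by move=> a b /I0 -> _; rewrite mul0r.
case: n n0 => // n _ /z /eqP; rewrite mulf_eq0 => /orP[] /eqP // s0.
by case: Is; apply/I0.
Qed.

Lemma symbolic_power_linear_bound (K : fieldType) (D : nat)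
    (I : {mpoly K[3]} -> Prop) :
  homogeneous_ideal I -> is_radical I -> generated_in_degrees_le D I ->
  (exists2 g, I g & g != 0) ->
  exists s, forall n, generated_in_degrees_le (n * D + s) (symbolic_power I n).
Proof.
move=> homI radI genI [g Ig g0]; have [idI hI] := homI.
have [I0 ID IM] := idI.
have gI := generated_by_forms_le homI genI.
have [f [d [hf f0 If fmax]]] := max_homogeneous_factor Ig g0.
pose J x := I (f * x).
have JI y : J y <-> I (f * y) by [].
have dD := degree_common_factor_le hf If gI Ig g0.
have gJ := generated_by_forms_quotient hf f0 gI JI If.
have homJ : homogeneous_ideal J.
  split; first split.
  - by rewrite /J mulr0.
  - by move=> a b Ja Jb; rewrite /J mulrDr; apply: ID.
  - by move=> a b Jb; rewrite /J mulrCA; apply: IM.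
  by move=> x e Jx; rewrite /J -(pihomogMX _ _ hf); apply: hI.
have [idJ _] := homJ.
have radJ : is_radical J.
  (* The power [(f * a) ^+ k.+1] is [f ^+ k * a] times [f * a ^+ k], and the latter is in [I]. *)
  move=> a k Jak; apply: (radI _ k.+1).
  rewrite exprMn exprSr [a ^+ _]exprS mulrACA.
  exact: IM.
have Jp p e : prime_elt p -> p \is e.-homog -> exists2 j, J j & ~ divides p j.
  move=> pp hp; apply: NNPP => N.
  have pJ j : J j -> divides p j by move=> Jj; apply: NNPP => pj; apply: N; exists j.
  have p0 : p != 0 by case: pp.
  (* A prime form dividing all of [J] would make [f * p] a common factor of [I] of larger degree. *)
  have := fmax (f * p) (d + e)%N (dhomogM hf hp) (mulf_neq0 f0 p0).
  have e0 := prime_elt_dhomog_gt0 pp hp.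
  suff fpI x : I x -> divides (f * p) x by move=> /(_ fpI); lia.
  move=> Ix; have [y xE] := If x Ix.
  have [|w yE] := pJ y; first by rewrite /J mulrC -xE.
  by exists w; rewrite xE yE -mulrA [p * f]mulrC.
have [y Jy y0] : exists2 x, J x & x != 0.
  have [y gE] := If g Ig; exists y; first by rewrite /J mulrC -gE.
  by apply: contraNneq g0 => y0; rewrite gE y0 mul0r.
have [l [c [s [c0 cs hl cov lJ]]]] := exists_covering_form homJ radJ (ex_intro2 _ _ y Jy y0) Jp.
have [u [ps fact]] := @factorial_domain_mpoly K 3 f f0; have [uu pps fE] := fact.
have Jps p : p \in ps -> exists2 j, J j & ~ divides p j.
  move=> pin; have [d' hp] : exists d, p \is d.-homog.
    exact: dhomog_prime_factor fact f0 hf pin.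
  by apply: Jp hp; apply: pps.
exists s => n.
have sf := symbolic_power_factor n _ idI idJ fact JI If Jps.
pose T := (s + n * (D - d))%N.
have lM : l = 0 \/ forall v, symbolic_power J n (l * v) -> symbolic_power J n v.
  case: lJ => [|lJ]; [by left|right=> v]; exact: symbolic_power_cancel.
have gM := generated_below (symbolic_power_homogeneous n homJ)
  (fun x => @ideal_pow_symbolic _ J n x idJ) hl c0 (leq_trans cs (leq_addr _ _))
  lM (covers_mod_pow homJ hl cs gJ cov).
exists (fun x => exists2 v, symbolic_power J n v /\ (msize v <= T.+1)%N & x = f ^+ n * v).
split.
  move=> x [v [_ sv] ->].
  have [->|v0] := eqVneq v 0; first by rewrite mulr0 msize0.
  rewrite msizeM ?expf_neq0 //.
  have := msize_dhomog (dhomogMn n hf); rewrite /T in sv.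
  nia.
move=> x; split.
  case/sf => v /gM Gv ->; move: v Gv; apply: sums_of_products_ind.
  - by rewrite mulr0; apply: sums_of_products0.
  - by move=> a b; rewrite mulrDr; apply: sums_of_productsD.
  move=> b v _ Mv; rewrite mulrCA; apply: sums_of_productsM => //.
  by exists v.
apply: generated_sub; first exact: symbolic_power_ideal.
by move=> _ [v [Mv _] ->]; apply/sf; exists v.
Qed.

Local Close Scope ring_scope.

Theorem mainTheorem1 (K : fieldType) (D : nat) (I : {mpoly K[3]} -> Prop)
    (homI : homogeneous_ideal I) (radI : is_radical I)
    (genI : generated_in_degrees_le D I) :
  exists n0 : nat, forall n : nat, n0 <= n ->
    generated_in_degrees_lt (D.+1 * n) (symbolic_power I n).
Proof.
have [nz|z] := classic (exists2 g, I g & g != 0%R).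
  have [s Hs] := symbolic_power_linear_bound homI radI genI nz.
  (* For [n > s], the size bound [n * D + s + 1] is at most [D.+1 * n]. *)
  exists s.+1 => n sn; have [S [SD SI]] := Hs n; exists S; split=> // x /SD sx.
  by apply: leq_trans sx _; rewrite mulSn [D * n]mulnC; lia.
have [idI _] := homI; have [I0 _ _] := idI.
exists 1 => n n0; exists (fun=> False); split=> // x; split; last first.
  by apply: generated_sub => //; apply: symbolic_power_ideal.
have z0 y : I y <-> y = 0%R.
  by split=> [Iy|-> //]; apply/eqP/negPn/negP => y0; apply: z; exists y.
by move/(symbolic_power_zero z0 n0) => ->; apply: sums_of_products0.
Qed.
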